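(* Let $(M^{2n},\omega)$ be a symplectic manifold. For any (complex) differential form $\alpha$ on $M$, $$d(e^{i\omega}e^{\frac{\Lambda}{2i}}\alpha)=e^{i\omega}e^{\frac{\Lambda}{2i}}\left(d\alpha-\frac{1}{2i}\delta\alpha\right).$$ Therefore $$\partial(e^{i\omega}e^{\frac{\Lambda}{2i}}\alpha)=e^{i\omega}e^{\frac{\Lambda}{2i}}d\alpha,\qquad \overline{\partial}(e^{i\omega}e^{\frac{\Lambda}{2i}}\alpha)=-e^{i\omega}e^{\frac{\Lambda}{2i}}\frac{1}{2i}\delta\alpha.$$ Hence the natural isomorphism $\varphi(\alpha)=e^{i\omega}e^{\frac{\Lambda}{2i}}\alpha$ of the space of complex differential forms is such that $$\varphi(d\alpha)=\partial\varphi(\alpha)\qquad\text{and}\qquad\varphi(\delta\alpha)=-2i\,\overline{\partial}\varphi(\alpha).$$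
   Context: $\Lambda$ is the operator on forms of interior product with the bivector $\omega^{-1}$, with sign normalized so that, in Darboux coordinates with $\omega=\sum_idx_i\wedge dy_i$, $\Lambda=\sum_i\iota_{\partial_{x_i}}\iota_{\partial_{y_i}}$ (so $\Lambda(dx_i\wedge dy_i)=-1$). The operator $\delta$ is $\delta=\Lambda d-d\Lambda$. Exponentials are $e^{\frac{\Lambda}{2i}}=\sum_j\frac1{j!}\left(\frac{\Lambda}{2i}\right)^j$, and $e^{i\omega}$ acts by wedge product. The generalized complex structure induced by $\omega$ has $+i$-eigenbundle $L=\{X-iX\lfloor\omega: X\in TM\otimes\mathbb{C}\}$, where $X\lfloor\omega$ denotes interior product, and induces the decomposition $\wedge^\bullet T^*M\otimes\mathbb{C}=\bigoplus_{k=-n}^nU^k$ with $U^n=\mathrm{span}\{e^{i\omega}\}$ and $U^{n-k}=\wedge^k\overline{L}\cdot e^{i\omega}$ (where $(X+\xi)\cdot\rho=X\lfloor\rho+\xi\wedge\rho$). Let $\mathcal{U}^k$ be the space of sections of $U^k$. Then $d:\mathcal{U}^k\to\mathcal{U}^{k+1}\oplus\mathcal{U}^{k-1}$ and $d=\partial+\overline{\partial}$, where $\partial:\mathcal{U}^k\to\mathcal{U}^{k+1}$ and $\overline{\partial}:\mathcal{U}^k\to\mathcal{U}^{k-1}$ are the corresponding projections of $d$.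
   Formalization: ∂ and ∂̄ are exchanged: with ∂:𝒰^k→𝒰^{k+1} the printed formulas fail (for a function f, ∂φ(f)=0 but φ(df)≠0), so what is proved is ∂̄φ(α)=φ(dα), ∂φ(α)=−φ(δα/2i), φ(δα)=−2i∂φ(α). *)

(* Defs.v *)
From HB Require Import structures.
From mathcomp Require Import all_boot all_order all_algebra.
From mathcomp Require Import complex.
From mathcomp Require Import all_classical all_reals all_analysis.
Set Implicit Arguments. Unset Strict Implicit. Unset Printing Implicit Defensive.
Import Order.TTheory GRing.Theory Num.Theory.
Import numFieldNormedType.Exports.
Local Open Scope classical_set_scope.
Local Open Scope ring_scope.

(** * Complexified exterior algebra of the dual of R^m *)
Section Exterior.
Variables (R : realType) (m : nat).
Local Notation C := R[i].

(* [a : ext] stands for \sum_I a I dx_I, where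
   dx_I = dx_i1 /\ ... /\ dx_ik for I = {i1 < ... < ik}. *)
Definition ext := {ffun {set 'I_m} -> C^o}.

Definition ext1 : ext := [ffun I => (I == finset.set0)%:R].

Definition koszul_sign (i : 'I_m) (I : {set 'I_m}) : C :=
  (-1) ^+ #|[pred j in I | (j < i)%N]|.

Definition dxw (i : 'I_m) (a : ext) : ext :=
  [ffun I : {set 'I_m} =>
     if i \in I then koszul_sign i I * a (I :\ i)%SET else 0].

Definition iota_ (i : 'I_m) (a : ext) : ext :=
  [ffun I : {set 'I_m} =>
     if i \in I then 0 else koszul_sign i I * a (i |: I)%SET].

Definition ext_wedge (a b : ext) : ext :=
  \sum_(I : {set 'I_m}) a I *: foldr dxw b (enum I).

Definition contr (X : 'rV[C]_m) (a : ext) : ext := \sum_i X 0 i *: iota_ i a.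

Definition homogeneous (k : nat) (a : ext) : Prop :=
  forall I : {set 'I_m}, a I != 0 -> #|I| = k.

(* [A i j] is the i-th partial derivative of the j-th coordinate, so that
   dx_j pulls back to \sum_i A i j dx_i. *)
Definition pullback (A : 'M[R]_m) (a : ext) : ext :=
  \sum_(J : {set 'I_m})
    a J *: foldr (fun j b => \sum_i (A i j)%:C%C *: dxw i b) ext1 (enum J).

(* Exponential of an operator T with T^(m+1) = 0; this covers T of degree 2
   and T of degree -2 on the exterior algebra. *)
Definition exp_op (T : ext -> ext) (a : ext) : ext :=
  \sum_(j < m.+1) (j`!%:R)^-1 *: iter j T a.

(** ** Linear algebra of a nondegenerate 2-form w *)

Definition form_mx (w : ext) : 'M[C]_m :=
  \matrix_(i, j) iota_ j (iota_ i w) finset.set0.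

(* The bivector w^-1 = 1/2 \sum_(i, j) P i j d_i /\ d_j with P the transposed
   inverse of (w(d_i, d_j)); for w = \sum_i dx_i /\ dy_i this gives
   Lambda w = \sum_i iota_(d_xi) iota_(d_yi). *)
Definition Lambda (w : ext) (a : ext) : ext :=
  2^-1 *: \sum_i \sum_j (invmx (form_mx w))^T i j *: iota_ i (iota_ j a).

Definition exp_Lambda (w : ext) : ext -> ext :=
  exp_op (fun a => (2 * 'i%C)^-1 *: Lambda w a).

Definition exp_iw (w : ext) : ext := exp_op (ext_wedge ('i%C *: w)) ext1.

Definition gen_tangent := ('rV[C]_m * ext)%type.

Definition gconj (v : gen_tangent) : gen_tangent :=
  (map_mx (@conjc R) v.1, [ffun I => conjc (v.2 I)]).

Definition clifford (v : gen_tangent) (a : ext) : ext :=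
  contr v.1 a + ext_wedge v.2 a.

(* Elements of the +i-eigenbundle L. *)
Definition Lvec (w : ext) (X : 'rV[C]_m) : gen_tangent :=
  (X, - 'i%C *: contr X w).

Definition Lbar_frame (w : ext) (i : 'I_m) : gen_tangent :=
  gconj (Lvec w (delta_mx 0 i)).

End Exterior.

(* U^(n-p) = /\^p Lbar . e^{iw}.  With l_i the above frame of Lbar, a basis of
   /\^p Lbar is given by the l_i1 /\ ... /\ l_ip, i1 < ... < ip; as Lbar is
   isotropic these act on forms by composing Clifford actions.  U^k is 0
   unless -n <= k <= n. *)
Definition Ubundle (R : realType) (n : nat) (w : ext R (2 * n)) (k : int) :
    {vspace ext R (2 * n)} :=
  (<<[seq foldr (fun i => clifford (Lbar_frame w i)) (exp_iw w) (enum J)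
     | J : {set 'I_(2 * n)} in
         [pred J : {set 'I_(2 * n)} | n%:Z - #|J|%:Z == k]]>>)%VS.

(* Projection onto U^k along the decomposition \bigoplus_(-n <= l <= n) U^l. *)
Definition Uproj (R : realType) (n : nat) (w : ext R (2 * n)) (k : int)
    (a : ext R (2 * n)) : ext R (2 * n) :=
  \sum_(j < (2 * n).+1 | n%:Z - j%:Z == k)
    sumv_pi (\sum_(l < (2 * n).+1) Ubundle w (n%:Z - l%:Z))%VS j a.

(** * Calculus on open subsets of R^m *)
Section Calculus.
Variables (R : realType) (m : nat).
Local Notation E := 'rV[R]_m.

Definition iter_partial (s : seq 'I_m) (f : E -> R) : E -> R :=
  foldr (fun i g => 'D_(delta_mx 0 i) g) f s.

Definition smooth_on (U : set E) (f : E -> R) : Prop :=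
  forall (s : seq 'I_m) (x : E), U x ->
    {for x, continuous (iter_partial s f)} /\
    forall i, derivable (iter_partial s f) x (delta_mx 0 i).

Definition smooth_onC (U : set E) (f : E -> R[i]) : Prop :=
  smooth_on U (fun x => complex.Re (f x)) /\
  smooth_on U (fun x => complex.Im (f x)).

Definition partialC (i : 'I_m) (f : E -> R[i]) (x : E) : R[i] :=
  ('D_(delta_mx 0 i) (fun y => complex.Re (f y)) x +i*
   'D_(delta_mx 0 i) (fun y => complex.Im (f y)) x)%C.

Definition ext_d (f : E -> ext R m) (x : E) : ext R m :=
  \sum_i dxw i [ffun I => partialC i (fun y => f y I) x].

End Calculus.

(** * Smooth manifolds *)

Record chart (R : realType) (m : nat) (T : topologicalType) := Chart {
  chart_dom : set T;
  chart_map : T -> 'rV[R]_m;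
  chart_inv : 'rV[R]_m -> T }.

Section Charts.
Variables (R : realType) (m : nat) (T : topologicalType).
Implicit Types c : chart R m T.

Definition chart_img c : set 'rV[R]_m := chart_map c @` chart_dom c.

Definition is_chart c : Prop :=
  [/\ open (chart_dom c), open (chart_img c),
      (forall p, chart_dom c p -> chart_inv c (chart_map c p) = p),
      {within chart_dom c, continuous (chart_map c)} &
      {within chart_img c, continuous (chart_inv c)}].

Definition transition c1 c2 (x : 'rV[R]_m) : 'rV[R]_m := chart_map c2 (chart_inv c1 x).

Definition overlap c1 c2 : set 'rV[R]_m := chart_map c1 @` (chart_dom c1 `&` chart_dom c2).

End Charts.

Record manifold (R : realType) (m : nat) := Manifold {
  carrier :> topologicalType;
  atlas : Type;
  chart_of : atlas -> chart R m carrier;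
  _ : hausdorff_space carrier;
  _ : @second_countable carrier;
  _ : forall c, is_chart (chart_of c);
  _ : forall p : carrier, exists c, chart_dom (chart_of c) p;
  _ : forall c1 c2 j, smooth_on (overlap (chart_of c1) (chart_of c2))
        (fun x => transition (chart_of c1) (chart_of c2) x 0 j) }.

(** * Complex differential forms *)

(* A form is given by its local expressions in the charts of the atlas, on the
   images of the charts (values outside are irrelevant, whence [eqform]). *)
Definition local_exprs (R : realType) (m : nat) (M : manifold R m) : Type :=
  atlas M -> 'rV[R]_m -> ext R m.

Section Forms.
Variables (R : realType) (m : nat) (M : manifold R m).
Implicit Types a b : local_exprs M.

Definition is_form a : Prop :=
  (forall c I, smooth_onC (chart_img (chart_of c)) (fun x => a c x I)) /\
  (forall c1 c2 x, overlap (chart_of c1) (chart_of c2) x ->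
     let F := transition (chart_of c1) (chart_of c2) in
     a c1 x = pullback ('J F x) (a c2 (F x))).

Definition eqform a b : Prop :=
  forall c x, chart_img (chart_of c) x -> a c x = b c x.

Definition dform a : local_exprs M := fun c => ext_d (a c).

Definition form_add a b : local_exprs M := fun c x => a c x + b c x.
Definition form_scale (z : R[i]) a : local_exprs M := fun c x => z *: a c x.

Definition linear_iso (F : local_exprs M -> local_exprs M) : Prop :=
  [/\ (forall a, is_form a -> is_form (F a)),
      (forall z a b, is_form a -> is_form b ->
         eqform (F (form_add (form_scale z a) b)) (form_add (form_scale z (F a)) (F b))),
      (forall a b, is_form a -> is_form b -> eqform (F a) (F b) -> eqform a b) &
      (forall b, is_form b -> exists2 a, is_form a & eqform (F a) b)].

Definition symplectic (w : local_exprs M) : Prop :=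
  [/\ is_form w,
      (forall c x, chart_img (chart_of c) x ->
         homogeneous 2 (w c x) /\ (forall I, complex.Im (w c x I) = 0)),
      eqform (dform w) (fun _ _ => 0) &
      (forall c x, chart_img (chart_of c) x -> forall X : 'rV[R]_m,
         contr (map_mx (real_complex R) X) (w c x) = 0 -> X = 0)].

Definition Lambdaf (w a : local_exprs M) : local_exprs M :=
  fun c x => Lambda (w c x) (a c x).

Definition deltaf (w a : local_exprs M) : local_exprs M :=
  form_add (Lambdaf w (dform a)) (form_scale (-1) (dform (Lambdaf w a))).

Definition phi (w a : local_exprs M) : local_exprs M :=
  fun c x => ext_wedge (exp_iw (w c x)) (exp_Lambda (w c x) (a c x)).

End Forms.

Section Dolbeault.
Variables (R : realType) (n : nat) (M : manifold R (2 * n)).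
Implicit Types w rho : local_exprs M.

Definition Uprojf w (k : int) rho : local_exprs M :=
  fun c x => Uproj (w c x) k (rho c x).

(* Sum over k of the components U^k -> U^(k+s) of d. *)
Definition d_shift (s : int) w rho : local_exprs M :=
  fun c x => \sum_(j < (2 * n).+1)
    let k := n%:Z - j%:Z in Uprojf w (k + s) (dform (Uprojf w k rho)) c x.

(* Since phi maps forms of degree p to sections of U^(n-p), raising the degree
   by one under phi lowers the grading of U by one: under phi, the operator d
   corresponds to delbar and delta to del. *)
Definition del w rho := d_shift 1 w rho.
Definition delbar w rho := d_shift (-1) w rho.

End Dolbeault.

(* Main.v *)
Require Import Defs.
From HB Require Import structures.
From mathcomp Require Import all_boot all_order all_algebra.
From mathcomp Require Import complex.
From mathcomp Require Import all_classical all_reals all_analysis.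
From mathcomp Require Import ring.
Set Implicit Arguments. Unset Strict Implicit. Unset Printing Implicit Defensive.
Import Order.TTheory GRing.Theory Num.Theory.
Import numFieldNormedType.Exports.
Local Open Scope ring_scope.

(** In the coordinates of a chart the operators dx_i /\ and iota_j satisfy the
canonical anticommutation relations.  A 2-form w with matrix W acts by wedge
product as the quadratic operator 1/2 \sum W_ij dx_i dx_j, and Lambda is
1/2 \sum P_ij iota_i iota_j with P = - W^-1.  The commutator of a generator
with a quadratic operator in the generators of the other kind is a linear
combination of the latter (quad_comm), so that exponentials of quadratic
operators conjugate generators in closed form (expq_comm):

  dx_k phi = phi (dx_k + eta_k / 2i)  with  eta_k = \sum_j P_kj iota_j,
  iota_k phi = phi (iota_k / 2 + i \sum_j W_kj dx_j).

The partial derivatives of phi (f) along the coordinates follow the same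
pattern, with the derivatives of W and P in place of commutators (dpart_Phi).
Let f_k be the partial derivatives of f and L_k the operator Lambda with P
replaced by its k-th partial derivative.  The terms from e^(iw) add up to the
wedge product with dw = 0, and the rest is

  d phi(f) = phi (\sum_k (dx_k + eta_k / 2i) (f_k + L_k f / 2i)).

Here \sum_k eta_k L_k = 0: differentiating W P = -1 identifies this sum, up to
sign, with the image of dw under the homomorphism dx_k |-> eta_k, which is the
usual proof that w^-1 is a Poisson bivector
(sum_eta_quad_dPoisson).  The remaining terms are df and - (delta f) / 2i
(commutator_Lambda_d, ext_d_Phi).

Combining the two conjugation formulas, the frame of Lbar acts on phi (a) as
the exterior multiplication of a by the 1-forms 2i iota_k w, because the
contractions cancel (clifford_Phi).  These 1-forms are a basis and
phi (1) = e^(iw), so phi maps the forms of degree p onto U^(n-p), and the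
projection onto U^k becomes the projection onto degree n - k (Uproj_Phi).  As d
raises the degree by one and delta lowers it by one, the two projections of d
separate the two terms of the first identity (d_lower_Phi, d_raise_Phi).

Finally, phi commutes with pullbacks (hom_Phi) and involves only sums, products
and the inverse of det W, so it preserves forms; its inverse
e^(-Lambda/2i) e^(-iw) does as well. *)

(** * Canonical anticommutation relations *)

Section ExteriorAlgebra.
Variables (R : realType) (m : nat).
Local Notation C := R[i].
Local Notation ext := (ext R m).
Implicit Types (a b : ext) (i j k : 'I_m) (I J : {set 'I_m}).

Lemma extZE (z : C) a I : (z *: a) I = z * a I.
Proof. by rewrite ffunE. Qed.

Lemma ext_sumE (A : Type) (r : seq A) (P : pred A) (F : A -> ext) I :
  (\sum_(x <- r | P x) F x) I = \sum_(x <- r | P x) F x I.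
Proof. by elim/big_rec2: _ => [|x y1 y2 _ <-]; rewrite ffunE. Qed.

Fact dxw_is_linear i : linear (@dxw R m i).
Proof.
move=> z a b; apply/ffunP => I; rewrite !ffunE.
by case: ifP => _; rewrite ?scaler0 ?addr0 // mulrDr mulrCA.
Qed.
HB.instance Definition _ i :=
  GRing.isLinear.Build C ext ext *:%R (@dxw R m i) (dxw_is_linear i).

Fact iota_is_linear i : linear (@iota_ R m i).
Proof.
move=> z a b; apply/ffunP => I; rewrite !ffunE.
by case: ifP => _; rewrite ?scaler0 ?addr0 // mulrDr mulrCA.
Qed.
HB.instance Definition _ i :=
  GRing.isLinear.Build C ext ext *:%R (@iota_ R m i) (iota_is_linear i).

Lemma koszul_signK i I : koszul_sign R i I * koszul_sign R i I = 1.
Proof. by rewrite /koszul_sign -expr2 sqrr_sign. Qed.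

Lemma koszul_signU1 i j I : i \notin I ->
  koszul_sign R j (i |: I)%SET = (-1) ^+ (i < j)%N * koszul_sign R j I.
Proof.
move=> iI; rewrite /koszul_sign -exprD; congr (_ ^+ _).
rewrite (cardD1 i) !inE eqxx /=; congr addn; apply: eq_card => k.
by rewrite !inE; case: eqVneq => [->|//]; rewrite (negbTE iI).
Qed.

Lemma koszul_signD1 i j I : i \in I ->
  koszul_sign R j I = (-1) ^+ (i < j)%N * koszul_sign R j (I :\ i)%SET.
Proof.
by move=> iI; rewrite -{1}(finset.setD1K iI) koszul_signU1 // !inE eqxx.
Qed.

Lemma ltn_neq_ord i j : i != j -> (i < j)%N = ~~ (j < i)%N.
Proof. by move=> ij; rewrite -leqNgt ltn_neqAle ij. Qed.

Lemma dxw_anticomm i j a : dxw i (dxw j a) = - dxw j (dxw i a).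
Proof.
apply/ffunP => I; rewrite !ffunE !inE.
have [<-|ij] := eqVneq i j; first by case: ifP; rewrite ?mulr0 oppr0.
have [iI|iI] := boolP (i \in I); have [jI|jI] := boolP (j \in I);
  rewrite ?mulr0 ?oppr0 //=.
rewrite (koszul_signD1 i jI) (koszul_signD1 j iI).
rewrite (_ : I :\ i :\ j = I :\ j :\ i)%SET; last first.
  by apply/finset.setP => k; rewrite !inE andbCA.
by rewrite (ltn_neq_ord ij); case: (j < i)%N; rewrite ?expr0 ?expr1; ring.
Qed.

Lemma iota_anticomm i j a : iota_ i (iota_ j a) = - iota_ j (iota_ i a).
Proof.
apply/ffunP => I; rewrite !ffunE !inE.
have [<-|ij] := eqVneq i j; first by case: ifP; rewrite ?mulr0 oppr0.
have [iI|iI] := boolP (i \in I); have [jI|jI] := boolP (j \in I);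
  rewrite ?mulr0 ?oppr0 //=.
rewrite !koszul_signU1 //.
rewrite (_ : j |: (i |: I) = i |: (j |: I))%SET; last first.
  by apply/finset.setP => k; rewrite !inE orbCA.
by rewrite (ltn_neq_ord ij); case: (j < i)%N; rewrite ?expr0 ?expr1; ring.
Qed.

Lemma iota_dxw i j a :
  iota_ i (dxw j a) = - dxw j (iota_ i a) + (i == j)%:R *: a.
Proof.
apply/ffunP => I; rewrite !ffunE !inE.
have [<-|ij] := eqVneq i j.
  have [iI|iI] /= := boolP (i \in I).
    rewrite finset.setD1K // (koszul_signD1 i iI) ltnn mul1r mulrA koszul_signK.
    by rewrite mul1r scale1r addNr.
  rewrite koszul_signU1 // ltnn mul1r mulrA koszul_signK finset.setU1K //.
  by rewrite mul1r scale1r oppr0 add0r.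
rewrite scale0r addr0.
have [iI|iI] := boolP (i \in I); have [jI|jI] := boolP (j \in I);
  rewrite ?mulr0 ?oppr0 //=.
rewrite koszul_signU1 // (koszul_signD1 i jI).
rewrite (_ : (i |: I) :\ j = i |: (I :\ j))%SET; last first.
  by apply/finset.setP => k; rewrite !inE; case: eqVneq => //= ->; case: eqVneq ij.
by rewrite (ltn_neq_ord ij); case: (j < i)%N; rewrite ?expr0 ?expr1; ring.
Qed.

Lemma dxw_iota i j a :
  dxw i (iota_ j a) = - iota_ j (dxw i a) + (i == j)%:R *: a.
Proof. by rewrite iota_dxw opprD opprK [j == i]eq_sym subrK. Qed.

Lemma iota_ext1 i : iota_ i (ext1 R m) = 0.
Proof.
apply/ffunP => I; rewrite !ffunE; case: ifP => // iI.
case: eqP => [/finset.setP/(_ i)|_]; last by rewrite mulr0.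
by rewrite !inE eqxx.
Qed.

Definition extb I : ext := [ffun K => (K == I)%:R].

Lemma extZbE (z : C) I K : (z *: extb I) K = z * (K == I)%:R.
Proof. by rewrite !ffunE. Qed.

Lemma ext_decomp a : a = \sum_(I : {set 'I_m}) a I *: extb I.
Proof.
apply/ffunP => K; rewrite ext_sumE (eq_bigr _ (fun I _ => extZbE (a I) I K)).
rewrite (bigD1 K) //= eqxx mulr1 big1 ?addr0 // => I.
by rewrite eq_sym => /negbTE ->; rewrite mulr0.
Qed.

Lemma dxw_extb i I : dxw i (extb I) =
  if i \in I then 0 else koszul_sign R i I *: extb (i |: I).
Proof.
apply/ffunP => K; rewrite !ffunE; case: ifPn => iK.
  case: ifPn => iI.
    case: eqP => [e|_]; last by rewrite mulr0 ffunE.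
    by rewrite -e !inE eqxx in iI.
  rewrite extZbE -[K in koszul_sign _ _ K](finset.setD1K iK).
  rewrite koszul_signU1 ?inE ?eqxx // ltnn mul1r.
  have [<-|ne] := eqVneq (K :\ i)%SET I; first by rewrite finset.setD1K // eqxx.
  case: eqP => [e|_]; last by rewrite !mulr0.
  by rewrite e finset.setU1K // eqxx in ne.
case: ifPn => iI; last rewrite extZbE; rewrite ?ffunE //.
case: eqP => [e|_]; last by rewrite mulr0.
by rewrite e !inE eqxx in iK.
Qed.

(** The Koszul sign counts the elements that precede i in the increasing
    enumeration, that is, the factors which i passes when it is inserted. *)
Lemma enum_setU1 i I : i \notin I -> exists s1 s2,
  [/\ enum I = s1 ++ s2, enum (i |: I)%SET = s1 ++ i :: s2
    & size s1 = #|[pred j in I | (j < i)%N]|].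
Proof.
move=> iI; have : i \in enum 'I_m by rewrite mem_enum.
case/path.splitPr def_e : _ / => [s1 s2].
have := enum_uniq 'I_m; rewrite def_e cat_uniq /= => /and3P[_ /norP[i1 _] /andP[i2 _]].
have : sorted ltn (map val (enum 'I_m)) by rewrite val_enum_ord iota_ltn_sorted.
rewrite def_e sorted_pairwise; last exact: ltn_trans.
rewrite map_cat pairwise_cat /= => /and4P[/allrelP s1i _ s2i _].
have eU s : i \notin s -> [seq j <- s | j \in (i |: I)%SET] = [seq j <- s | j \in I].
  move=> ni; apply: eq_in_filter => j js; rewrite !inE.
  by case: eqVneq => // e; rewrite -e js in ni.
have eI (A : {set 'I_m}) : enum A = [seq j <- s1 ++ i :: s2 | j \in A].
  by rewrite -def_e enumT.
exists [seq j <- s1 | j \in I], [seq j <- s2 | j \in I]; split.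
- by rewrite eI filter_cat /= (negbTE iI).
- by rewrite eI filter_cat /= !inE eqxx !eU.
- have -> : #|[pred j in I | (j < i)%N]| = count (fun j => (j \in I) && (j < i)%N) (s1 ++ i :: s2).
    by rewrite -def_e cardE -size_filter enumT.
  rewrite count_cat /= ltnn andbF size_filter add0n.
  rewrite [X in (_ + X)%N](_ : _ = 0)%N ?addn0.
    apply: eq_in_count => j js.
    by have /= -> := s1i (val j) (val i); rewrite ?andbT ?map_f // inE eqxx.
  apply/eqP; rewrite -[_ == _]negbK -lt0n -has_count -all_predC.
  apply/allP => j js /=; rewrite negb_and -leqNgt ltnW ?orbT //.
  by move/allP: s2i; apply; apply: map_f.
Qed.

(** ** Algebra homomorphisms out of the exterior algebra *)

Section ExtAct.
Variable t : 'I_m -> {linear ext -> ext}.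
Hypothesis tA : forall i j v, t i (t j v) = - t j (t i v).

(** The action on [b] of the image of [a] under the algebra homomorphism that
    sends dx_i to [t i].  For [t i] = dx_i /\ this is the wedge product; for
    [t i] a combination of the dx_j, and [b] = 1, it is a pullback. *)
Definition ext_act a b : ext := \sum_(I : {set 'I_m}) a I *: foldr t b (enum I).

Lemma foldr_linear s : linear (fun b => foldr t b s).
Proof. by move=> z a b; elim: s => //= i s ->; rewrite linearP. Qed.

Lemma ext_actPl b : linear (ext_act^~ b).
Proof.
move=> z a a'; rewrite /ext_act scaler_sumr -big_split /=.
by apply: eq_bigr => I _; rewrite !ffunE scalerDl scalerA.
Qed.

Lemma ext_actPr a : linear (ext_act a).
Proof.
move=> z b b'; rewrite /ext_act scaler_sumr -big_split /=.
by apply: eq_bigr => I _; rewrite foldr_linear scalerDr !scalerA mulrC.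
Qed.

HB.instance Definition _ a :=
  GRing.isLinear.Build C ext ext *:%R (ext_act a) (ext_actPr a).

Lemma ext_act0l b : ext_act 0 b = 0.
Proof. by rewrite /ext_act big1 // => I _; rewrite ffunE scale0r. Qed.

Lemma ext_actZl z a b : ext_act (z *: a) b = z *: ext_act a b.
Proof. by have := ext_actPl b z a 0; rewrite /= ext_act0l !addr0. Qed.

Lemma ext_act_suml (A : Type) (r : seq A) (P : pred A) (v : A -> ext) b :
  ext_act (\sum_(x <- r | P x) v x) b = \sum_(x <- r | P x) ext_act (v x) b.
Proof.
elim/big_rec2: _ => [|x y1 y2 _ IH]; first exact: ext_act0l.
by have := ext_actPl b 1 (v x) y2; rewrite /= !scale1r IH.
Qed.

Lemma ext_act_extb I b : ext_act (extb I) b = foldr t b (enum I).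
Proof.
rewrite /ext_act (bigD1 I) //= ffunE eqxx scale1r big1 ?addr0 // => J /negbTE ne.
by rewrite ffunE ne scale0r.
Qed.

Lemma anticomm_foldr i b s : t i (foldr t b s) = (-1) ^+ size s *: foldr t (t i b) s.
Proof.
elim: s => [|j s IH] /=; first by rewrite scale1r.
by rewrite tA IH linearZ exprS mulN1r scaleNr.
Qed.

Lemma anticomm_sq i b : t i (t i b) = 0.
Proof.
have := tA i i b; move/eqP; rewrite -addr_eq0 -mulr2n -scaler_nat scaler_eq0.
by rewrite pnatr_eq0 /= => /eqP.
Qed.

Lemma anticomm_foldr_cat i b s1 s2 :
  t i (foldr t b (s1 ++ i :: s2)) = 0.
Proof.
rewrite foldr_cat anticomm_foldr /= anticomm_sq.
suff -> : foldr t 0 s1 = 0 by rewrite scaler0.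
by elim: s1 => //= j s ->; rewrite linear0.
Qed.

(** Moving [t i] past the factors of smaller index costs the Koszul sign, and a
    repeated factor gives zero on both sides. *)
Lemma ext_act_dxw i a b : ext_act (dxw i a) b = t i (ext_act a b).
Proof.
rewrite [a in LHS]ext_decomp [a in RHS]ext_decomp linear_sum /=.
under eq_bigr do rewrite linearZ.
rewrite !ext_act_suml linear_sum; apply: eq_bigr => I _.
rewrite !ext_actZl linearZ; congr (_ *: _).
rewrite /= dxw_extb; case: ifPn => iI.
  rewrite ext_act_extb -(finset.setD1K iI).
  have [|s1 [s2 [_ -> _]]] := @enum_setU1 i (I :\ i)%SET; first by rewrite !inE eqxx.
  rewrite anticomm_foldr_cat.
  exact: ext_act0l.
have [s1 [s2 [e eU es]]] := enum_setU1 iI.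
rewrite ext_actZl !ext_act_extb e eU !foldr_cat anticomm_foldr /= /koszul_sign -es.
by rewrite anticomm_foldr.
Qed.

Lemma ext_act1 b : ext_act (ext1 R m) b = b.
Proof.
rewrite (_ : ext1 R m = extb finset.set0) ?ext_act_extb ?enum_set0 //.
Qed.

(** Among more than [m] of the [t i] one occurs twice. *)
Lemma anticomm_foldr0 b s : (m < size s)%N -> foldr t b s = 0.
Proof.
move=> ms; have : ~~ uniq s.
  apply/negP => us; move: ms; rewrite ltnNge; apply/negP/negPn.
  by rewrite -(card_uniqP us) (leq_trans (max_card _)) // card_ord.
elim: s {ms} => //= i s IH; rewrite negb_and negbK => /orP[|/IH ->].
  by case/path.splitPr => s1 s2; rewrite anticomm_foldr_cat.
by rewrite linear0.
Qed.

End ExtAct.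

End ExteriorAlgebra.

(** * Forms of degree two *)

Section Degree.
Variables (R : realType) (m : nat).
Local Notation ext := (ext R m).
Implicit Types (a b : ext) (i j k : 'I_m) (I J : {set 'I_m}).

(** The dx_i generate the exterior algebra from 1, so a linear identity needs to
    be followed only through exterior multiplication by generators. *)
Lemma ext_ind (P : ext -> Prop) :
    (forall z a b, P a -> P b -> P (z *: a + b)) -> P (ext1 R m) ->
    (forall i a, P a -> P (dxw i a)) ->
  forall a, P a.
Proof.
move=> Plin P1 Pdx a.
have P0 : P 0 by rewrite -(addNr (ext1 R m)) -scaleN1r; apply: Plin.
have Pb I : P (extb R I).
  move: {2}_.+1 (ltnSn #|I|) => N; elim: N => // N IH in I *; rewrite ltnS => leN.
  have [->|[i iI]] := finset.set_0Vmem I; first exact: P1.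
  have := dxw_extb R i (I :\ i)%SET; rewrite !inE eqxx /= finset.setD1K // => e.
  rewrite -[extb R I]scale1r -(koszul_signK R i (I :\ i)%SET) -scalerA -e.
  rewrite -[_ *: _]addr0; apply: Plin => //; apply/Pdx/IH.
  by move: leN; rewrite (cardsD1 i I) iI.
rewrite [a]ext_decomp; elim/big_rec: _ => // I b _ Pb'; exact: Plin.
Qed.

Lemma homogeneousP (p : nat) a :
  homogeneous p a <-> forall I, #|I| != p -> a I = 0.
Proof.
split=> h I; last by move=> aI; apply: contra_neq_eq aI => /h.
by move=> Ip; apply: contraNeq Ip => aI; apply/eqP/h.
Qed.

Lemma homogeneous_iota p i a : homogeneous p.+1 a -> homogeneous p (iota_ i a).
Proof.
move=> /homogeneousP ha; apply/homogeneousP => I Ip; rewrite ffunE.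
by case: ifPn => // iI; rewrite ha ?mulr0 // cardsU1 iI.
Qed.

Lemma homogeneous0 a : homogeneous 0 a -> a = a finset.set0 *: ext1 R m.
Proof.
move=> /homogeneousP ha; apply/ffunP => I; rewrite (extZbE _ finset.set0).
by case: eqVneq => [->|I0]; rewrite ?mulr1 // mulr0 ha // cards_eq0.
Qed.

(** Euler's identity: dx_i iota_i is the projection onto the span of the dx_I with
    i in I. *)
Lemma sum_dxw_iota p a : homogeneous p a ->
  \sum_i dxw i (iota_ i a) = p%:R *: a.
Proof.
move=> ha; apply/ffunP => I; rewrite extZE ext_sumE.
rewrite (eq_bigr (fun i => if i \in I then a I else 0)) => [|i _]; last first.
  rewrite !ffunE !inE eqxx /=; case: ifPn => // iI.
  by rewrite finset.setD1K // (koszul_signD1 _ i iI) ltnn mul1r mulrA koszul_signK mul1r.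
transitivity (\sum_(i in I) a I); first by rewrite [RHS]big_mkcond.
rewrite sumr_const mulr_natl.
by have [->|/ha ->] := eqVneq (a I) 0; rewrite ?mul0rn.
Qed.

Lemma form_mx_antisym (w : ext) : (form_mx w)^T = - form_mx w.
Proof. by apply/matrixP => i j; rewrite !mxE iota_anticomm ffunE. Qed.

Lemma iota_hom2 (w : ext) i : homogeneous 2 w ->
  iota_ i w = \sum_j form_mx w i j *: dxw j (ext1 R m).
Proof.
move=> hw; have h1 := homogeneous_iota (i := i) hw.
have := sum_dxw_iota h1; rewrite scale1r => <-.
apply: eq_bigr => j _; rewrite [iota_ j _]homogeneous0; last exact: homogeneous_iota.
by rewrite linearZ mxE.
Qed.

(** Euler's identity for [w] and for the 1-forms iota_i w. *)
Lemma hom2_decomp (w : ext) : homogeneous 2 w ->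
  w = 2^-1 *: \sum_i \sum_j form_mx w i j *: dxw i (dxw j (ext1 R m)).
Proof.
move=> hw; transitivity (2^-1 *: \sum_i dxw i (iota_ i w)).
  by rewrite (sum_dxw_iota hw) scalerA mulVf ?pnatr_eq0 // scale1r.
congr (_ *: _); apply: eq_bigr => i _; rewrite (iota_hom2 i hw) linear_sum.
by apply: eq_bigr => j _; rewrite linearZ.
Qed.

End Degree.

(** * Quadratic operators in anticommuting generators *)

(** Exterior multiplication by a 2-form is of this kind, with generators dx_i and
    matrix [form_mx w], and so is Lambda, with generators iota_i and the matrix of
    the bivector. *)
HB.lock Definition quad (R : realType) (m : nat)
    (t : 'I_m -> {linear ext R m -> ext R m}) (A : 'M[R[i]]_m) (b : ext R m) : ext R m :=
  2^-1 *: \sum_i \sum_j A i j *: t i (t j b).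

Section Quadratic.
Variables (R : realType) (m : nat).
Local Notation C := R[i].
Local Notation ext := (ext R m).
Implicit Types (a b : ext) (i j k : 'I_m).
Variable t : 'I_m -> {linear ext -> ext}.
Hypothesis tA : forall i j v, t i (t j v) = - t j (t i v).

Local Notation quad := (quad t).

Lemma quadE A b : quad A b = 2^-1 *: \sum_i \sum_j A i j *: t i (t j b).
Proof. by rewrite quad.unlock. Qed.

Lemma ext_act_hom2 (w : ext) b : homogeneous 2 w ->
  ext_act t w b = quad (form_mx w) b.
Proof.
move=> hw; rewrite {1}(hom2_decomp hw) quadE ext_actZl ext_act_suml; congr (_ *: _).
apply: eq_bigr => i _; rewrite ext_act_suml; apply: eq_bigr => j _.
by rewrite ext_actZl !(ext_act_dxw tA) (ext_act1 t b).
Qed.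

Fact quad_is_linear A : linear (quad A).
Proof.
move=> z a b; rewrite !quadE scalerA mulrC -scalerA -scalerDr; congr (_ *: _).
rewrite scaler_sumr -big_split; apply: eq_bigr => i _ /=.
rewrite scaler_sumr -big_split; apply: eq_bigr => j _ /=.
by rewrite (linearP (t j)) (linearP (t i)) scalerDr !scalerA [z * _]mulrC.
Qed.
HB.instance Definition _ A :=
  GRing.isLinear.Build C ext ext *:%R (quad A) (quad_is_linear A).

Lemma quadZ z A b : quad (z *: A) b = z *: quad A b.
Proof.
rewrite !quadE scalerA mulrC -scalerA; congr (_ *: _).
rewrite scaler_sumr; apply: eq_bigr => i _; rewrite scaler_sumr.
by apply: eq_bigr => j _; rewrite mxE scalerA.
Qed.

Lemma quadN A b : quad (- A) b = - quad A b.
Proof. by rewrite -scaleN1r quadZ scaleN1r. Qed.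

Section QuadComm.
Variables (X : {linear ext -> ext}) (s : 'I_m -> C).
Hypothesis Xt : forall i v, X (t i v) = - t i (X v) + s i *: v.

(** The contractions of [X] with the first and the second factor of t_i t_j
    contribute equally, as [A] is antisymmetric; this cancels the 1/2. *)
Lemma quad_comm (A : 'M[C]_m) b : A^T = - A ->
  X (quad A b) = quad A (X b) + \sum_i \sum_j (s i * A i j) *: t j b.
Proof.
move=> antiA; rewrite !quadE linearZ /= linear_sum /=.
have e i j : X (A i j *: t i (t j b)) =
  A i j *: t i (t j (X b)) + (s i * A i j) *: t j b - (s j * A i j) *: t i b.
  rewrite (linearZ_LR X) Xt Xt (linearD (t i)) (linearN (t i)) (linearZ_LR (t i)).
  rewrite opprD opprK !scalerDr scalerN !scalerA.
  by rewrite [A i j * s j]mulrC [A i j * s i]mulrC addrAC.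
rewrite (eq_bigr _ (fun i _ => linear_sum X _ _ _)).
rewrite (eq_bigr _ (fun i _ => eq_bigr _ (fun j _ => e i j))).
under eq_bigr do rewrite sumrB big_split /=.
rewrite sumrB big_split /= [X in _ - X]exchange_big /= !scalerDr -addrA; congr (_ + _).
rewrite -scalerDr -sumrB [in LHS](eq_bigr (fun i => 2 *: \sum_j (s i * A i j) *: t j b)).
  by rewrite -scaler_sumr scalerA mulVf ?pnatr_eq0 // scale1r.
move=> i _; rewrite -sumrB scaler_sumr; apply: eq_bigr => j _.
have /matrixP/(_ i j) := antiA; rewrite !mxE => ->.
by rewrite mulrN scaleNr opprK scalerA -mulr2n mulr_natl scalerMnl.
Qed.
End QuadComm.

(** Passing two anticommuting factors costs two signs. *)
Lemma quad_comm0 (X : {linear ext -> ext}) A b :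
  (forall i v, X (t i v) = - t i (X v)) -> X (quad A b) = quad A (X b).
Proof.
move=> Xt; rewrite !quadE linearZ /= linear_sum; congr (_ *: _); apply: eq_bigr => i _.
by rewrite linear_sum; apply: eq_bigr => j _; rewrite (linearZ_LR X) !Xt (linearN (t i)) opprK.
Qed.

Lemma quad_quad A B b : quad A (quad B b) = quad B (quad A b).
Proof.
rewrite [quad A b]quadE [quad A (quad B b)]quadE.
transitivity (2^-1 *: \sum_i \sum_j A i j *: quad B (t i (t j b))).
  congr (_ *: _); apply: eq_bigr => i _; apply: eq_bigr => j _; congr (_ *: _).
  by rewrite (quad_comm0 _ _ (tA j)) (quad_comm0 _ _ (tA i)).
rewrite (linearZ_LR (quad B)); congr (_ *: _).
rewrite (linear_sum (quad B)); apply: eq_bigr => i _.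
by rewrite (linear_sum (quad B)); apply: eq_bigr => j _; rewrite (linearZ_LR (quad B)).
Qed.

(** A product of [p] of the [t i], applied to any form, satisfies [fil p], since
    m + 1 factors give zero.  This measures nilpotency in the same way for the dx_i,
    which raise the degree, and the iota_i, which lower it. *)
Definition fil (p : nat) a :=
  forall s : seq 'I_m, (m < size s + p)%N -> foldr t a s = 0.

Lemma fil0 a : fil 0 a.
Proof. by move=> s; rewrite addn0; exact: anticomm_foldr0. Qed.

Lemma fil_zero p : fil p 0.
Proof. by move=> s _; elim: s => //= i s ->; rewrite linear0. Qed.

Lemma fil_lin p (z : C) a b : fil p a -> fil p b -> fil p (z *: a + b).
Proof. by move=> fa fb s ms; rewrite foldr_linear fa // fb // scaler0 addr0. Qed.

Lemma filZ p (z : C) a : fil p a -> fil p (z *: a).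
Proof. by move=> fa; rewrite -[_ *: _]addr0; apply: fil_lin fa (@fil_zero p). Qed.

Lemma fil_sum p (v : 'I_m -> ext) : (forall i, fil p (v i)) -> fil p (\sum_i v i).
Proof.
move=> fv; elim/big_rec: _ => [|i x _ fx]; first exact: fil_zero.
by rewrite -[v i]scale1r; apply: fil_lin.
Qed.

Lemma fil_t p i a : fil p a -> fil p.+1 (t i a).
Proof. by move=> fa s ms; rewrite -foldr_rcons fa // size_rcons addSnnS. Qed.

Lemma fil_quad p A a : fil p a -> fil p.+2 (quad A a).
Proof.
by move=> fa; rewrite quadE; apply/filZ/fil_sum => i; apply: fil_sum => j; do 3?[apply: filZ|apply: fil_t].
Qed.

Lemma fil_iter_quad p A a (n : nat) : fil p a -> fil (n.*2 + p) (iter n (quad A) a).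
Proof. by move=> fa; elim: n => //= n IH; apply: fil_quad. Qed.

Lemma fil_eq0 p a : (m < p)%N -> fil p a -> a = 0.
Proof. by move=> mp /(_ [::]); apply. Qed.

End Quadratic.

(** * Exponentials of nilpotent operators *)

Section TruncatedExponential.
Variables (C : numFieldType) (V : lmodType C) (m : nat).
Implicit Types a b : V.

Definition texp (T : V -> V) a : V := \sum_(j < m.+1) (j`!%:R)^-1 *: iter j T a.

Section Nilpotent.
Variable T : {linear V -> V}.

Lemma iter_linear n : linear (iter n T).
Proof. by move=> z a b; elim: n => //= n ->; rewrite linearP. Qed.

Lemma iterZ n z a : iter n T (z *: a) = z *: iter n T a.
Proof. by elim: n => //= n ->; rewrite (linearZ_LR T). Qed.

Lemma iter_sum n (I : Type) (r : seq I) (P : pred I) (v : I -> V) :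
  iter n T (\sum_(x <- r | P x) v x) = \sum_(x <- r | P x) iter n T (v x).
Proof. by elim: n => //= n ->; rewrite (linear_sum T). Qed.

Lemma texp_is_linear : linear (texp T).
Proof.
move=> z a b; rewrite /texp scaler_sumr -big_split; apply: eq_bigr => j _ /=.
by rewrite iter_linear scalerDr !scalerA mulrC.
Qed.

(** If X T^n a = T^n X a + n T^(n-1) [X, T] a then X e^T a = e^T (X a + [X, T] a).
    The values X T^n a enter as a sequence [u], so that X may also be the
    differentiation of a family of operators T; truncation of the series loses
    only the term T^m b. *)
Lemma texp_leibniz (u : nat -> V) a b :
    (forall n, u n = iter n T a + iter n.-1 T b *+ n) -> iter m T b = 0 ->
  \sum_(n < m.+1) (n`!%:R)^-1 *: u n = texp T (a + b).
Proof.
move=> eu b0; have -> : texp T (a + b) = texp T a + texp T b.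
  by have := texp_is_linear 1 a b; rewrite !scale1r.
under eq_bigr do rewrite eu scalerDr -scaler_nat.
rewrite big_split /=; congr (_ + _).
rewrite big_ord_recl /= scale0r scaler0 add0r /texp big_ord_recr /= b0 scaler0 addr0.
apply: eq_bigr => n _; rewrite scalerA; congr (_ *: _).
rewrite /bump /= add1n factS natrM invfM mulrC mulrA divff ?mul1r //.
Qed.

Lemma texpNK a : (forall b, iter m.+1 T b = 0) ->
  texp (fun b => - T b) (texp T a) = a.
Proof.
move=> nilT; have iterN n b : iter n (fun b => - T b) b = (-1) ^+ n *: iter n T b.
  elim: n => /= [|n ->]; first by rewrite scale1r.
  by rewrite (linearZ_LR T) exprS mulN1r scaleNr.
(* Polynomials modulo X^(m+1) act through T, and the truncations of e^(-X) and
   e^X have product 1 modulo X^(m+1). *)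
pose act (p : {poly C}) b : V := \sum_(i < m.+1) p`_i *: iter i T b.
have actM p q b : act (p * q) b = act p (act q b).
  elim/poly_ind: p => [|p c IH].
    have act0 v : act 0 v = 0 by rewrite /act big1 // => i _; rewrite coef0 scale0r.
    by rewrite mul0r !act0.
  have actXD (r s : {poly C}) v : act (r * 'X + s) v = act r (T v) + act s v.
    rewrite /act; under eq_bigr do rewrite coefD scalerDl.
    rewrite big_split /=; congr (_ + _).
    rewrite big_ord_recl /= coefMX eqxx scale0r add0r [RHS]big_ord_recr /=.
    rewrite -iterSr nilT scaler0 addr0; apply: eq_bigr => i _.
    by rewrite coefMX -iterSr.
  rewrite mulrDl -mulrA ['X * q]mulrC mulrA !actXD.
  have -> : act (p * q) (T b) = act p (T (act q b)).
    have : act (p * q) (T b) = T (act (p * q) b).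
      rewrite /act (linear_sum T); apply: eq_bigr => i _.
      by rewrite (linearZ_LR T) -iterS iterSr.
    rewrite IH => ->; rewrite /act (linear_sum T); apply: eq_bigr => i _.
    by rewrite (linearZ_LR T) -iterS iterSr.
  congr (_ + _).
  have actC v : act c%:P v = c *: v.
    rewrite /act big_ord_recl coefC eqxx big1 ?addr0 // => i _.
    by rewrite coefC scale0r.
  rewrite actC /act scaler_sumr; apply: eq_bigr => i _.
  by rewrite coefCM scalerA.
pose E (z : C) : {poly C} := \poly_(i < m.+1) (z ^+ i / i`!%:R).
have -> : texp T a = act (E 1) a.
  by apply: eq_bigr => i _; rewrite coef_poly ltn_ord expr1n mul1r.
have -> b : texp (fun b => - T b) b = act (E (- 1)) b.
  by apply: eq_bigr => i _; rewrite coef_poly ltn_ord iterN scalerA mulrC.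
rewrite -actM /act big_ord_recl big1 ?addr0.
  by rewrite coefM big_ord1 !coef_poly /= !expr0 fact0 invr1 !mulr1 scale1r.
move=> i _; rewrite coefM [X in X *: _](_ : _ = 0) ?scale0r //;
have : (0 < lift ord0 i)%N by []; move: (lift _ _ : nat) (ltn_ord (lift ord0 i)) => n nm n0.
(* The coefficient of X^n in e^(-X) e^X is (1 - 1)^n / n!. *)
transitivity ((1 - 1) ^+ n / n`!%:R : C); last first.
  by rewrite subrr expr0n eqn0Ngt n0 mul0r.
rewrite exprBn mulr_suml; apply: eq_bigr => j _.
have jn : (j <= n)%N by rewrite -ltnS.
rewrite !coef_poly (leq_ltn_trans jn) // (leq_ltn_trans (leq_subr j n)) //.
have fn0 q : q`!%:R != 0 :> C by rewrite pnatr_eq0 -lt0n fact_gt0.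
rewrite !expr1n !mulr1 div1r -[_ *+ 'C(n, j)]mulr_natr -(bin_fact jn) !natrM.
have b0 : ('C(n, j))%:R != 0 :> C by rewrite pnatr_eq0 -lt0n bin_gt0.
by field; rewrite !fn0 b0.
Qed.

End Nilpotent.
End TruncatedExponential.

Section ExpOp.
Variables (R : realType) (m : nat).
Local Notation C := R[i].
Local Notation ext := (ext R m).

Lemma eq_exp_op (T T' : ext -> ext) a : T =1 T' -> exp_op T a = exp_op T' a.
Proof. by move=> TT; apply: eq_bigr => j _; rewrite (eq_iter TT). Qed.

Lemma exp_opE (T : ext -> ext) a : exp_op T a = @texp C ext m T a.
Proof. by []. Qed.

Variable T : {linear ext -> ext}.

Lemma exp_op_fix a : T a = 0 -> exp_op T a = a.
Proof.
move=> Ta; rewrite /exp_op big_ord_recl big1 ?addr0 ?fact0 ?invr1 ?scale1r // => n _.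
rewrite -[lift _ _ : nat]/(n.+1); suff -> : iter n.+1 T a = 0 by rewrite scaler0.
by rewrite iterSr Ta; elim: (n : nat) => //= p ->; rewrite linear0.
Qed.

Lemma ext_iterZ n z a : iter n T (z *: a) = z *: iter n T a.
Proof. exact: (@iterZ C ext T n z a). Qed.

Lemma ext_iter_sum n (I : Type) (r : seq I) (P : pred I) (v : I -> ext) :
  iter n T (\sum_(x <- r | P x) v x) = \sum_(x <- r | P x) iter n T (v x).
Proof. exact: (@iter_sum C ext T n I r P v). Qed.

Lemma exp_op_is_linear : linear (exp_op T).
Proof. by move=> z a b; rewrite !exp_opE; apply: (@texp_is_linear C ext m T). Qed.

Lemma exp_op_leibniz (u : nat -> ext) a b :
    (forall n, u n = iter n T a + iter n.-1 T b *+ n) -> iter m T b = 0 ->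
  \sum_(n < m.+1) (n`!%:R)^-1 *: u n = exp_op T (a + b).
Proof. rewrite exp_opE; exact: (@texp_leibniz C ext m T). Qed.

Lemma exp_opNK a : (forall b, iter m.+1 T b = 0) ->
  exp_op (fun b => - T b) (exp_op T a) = a.
Proof. rewrite !exp_opE; exact: (@texpNK C ext m T). Qed.

End ExpOp.

(** * Exponentials of quadratic operators *)

HB.lock Definition expq (R : realType) (m : nat)
    (t : 'I_m -> {linear ext R m -> ext R m}) (A : 'M[R[i]]_m) : ext R m -> ext R m :=
  exp_op (quad t A).

HB.lock Definition lincomb (R : realType) (m : nat)
    (t : 'I_m -> {linear ext R m -> ext R m}) (B : 'M[R[i]]_m) (i : 'I_m)
    (a : ext R m) : ext R m :=
  \sum_j B i j *: t j a.

Section QuadExp.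
Variables (R : realType) (m : nat).
Local Notation C := R[i].
Local Notation ext := (ext R m).
Implicit Types (a b : ext) (i j k : 'I_m).
Variable t : 'I_m -> {linear ext -> ext}.
Local Notation expq := (expq t).
Local Notation lincomb := (lincomb t).

Lemma expqE A b : expq A b = exp_op (quad t A) b.
Proof. by rewrite expq.unlock. Qed.

Lemma lincombE B i a : lincomb B i a = \sum_j B i j *: t j a.
Proof. by rewrite lincomb.unlock. Qed.

Hypothesis tA : forall i j v, t i (t j v) = - t j (t i v).

Fact expq_is_linear A : linear (expq A).
Proof. by move=> z a b; rewrite !expqE; exact: (exp_op_is_linear (quad t A)). Qed.
HB.instance Definition _ A :=
  GRing.isLinear.Build C ext ext *:%R (expq A) (expq_is_linear A).

Lemma expqD A a b : expq A (a + b) = expq A a + expq A b.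
Proof. exact: (linearD (expq A)). Qed.

Lemma expqZ A z a : expq A (z *: a) = z *: expq A a.
Proof. exact: (linearZ_LR (expq A)). Qed.

Lemma quad_iter_t A i n b : t i (iter n (quad t A) b) = iter n (quad t A) (t i b).
Proof. by elim: n => //= n <-; rewrite (quad_comm0 _ _ (tA i)). Qed.

(** The commutator of [X] with the quadratic operator is a combination of the
    [t j], which commute with that operator. *)
Lemma expq_comm (X : {linear ext -> ext}) (s : 'I_m -> C) A a :
    (forall i v, X (t i v) = - t i (X v) + s i *: v) -> A^T = - A ->
  X (expq A a) = expq A (X a + \sum_i \sum_j (s i * A i j) *: t j a).
Proof.
move=> Xt antiA; rewrite !expqE.
pose Y v := \sum_i \sum_j (s i * A i j) *: t j v.
have YQ n v : Y (iter n (quad t A) v) = iter n (quad t A) (Y v).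
  rewrite /Y ext_iter_sum; apply: eq_bigr => i _; rewrite iter_sum.
  by apply: eq_bigr => j _; rewrite quad_iter_t ext_iterZ.
have XQ v : X (quad t A v) = quad t A (X v) + Y v := quad_comm Xt v antiA.
rewrite -[RHS](exp_op_leibniz (u := fun n => X (iter n (quad t A) a))).
- rewrite /exp_op (linear_sum X); apply: eq_bigr => n _.
  by rewrite (linearZ_LR X).
- elim=> [|n IH]; first by rewrite mulr0n addr0.
  rewrite iterS XQ IH YQ (linearD (quad t A)) /= (linearMn (quad t A)) -addrA.
  congr (_ + _); case: n {IH} => [|n]; first by rewrite mulr0n add0r.
  by rewrite /= [in RHS]mulrSr.
(* T^m contributes 2m factors and the commutator one more. *)
- apply: (@fil_eq0 _ _ t (m.*2 + 1)); first by rewrite addn1 -addnn ltnS leq_addr.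
  apply: fil_iter_quad; rewrite -/(Y a).
  apply: fil_sum => i; apply: fil_sum => j; apply/filZ/fil_t/fil0; exact: tA.
Qed.

Lemma expq_comm0 (X : {linear ext -> ext}) A a :
  (forall i v, X (t i v) = - t i (X v)) -> X (expq A a) = expq A (X a).
Proof.
move=> Xt; rewrite !expqE /exp_op (linear_sum X); apply: eq_bigr => n _.
rewrite (linearZ_LR X); congr (_ *: _).
by elim: (n : nat) => //= p <-; rewrite (quad_comm0 _ _ Xt).
Qed.

Lemma expqNK A a : expq (- A) (expq A a) = a.
Proof.
rewrite !expqE (eq_exp_op (T' := fun b => - quad t A b)); last exact: quadN.
apply: (exp_opNK (T := quad t A)) => b.
apply: (@fil_eq0 _ _ t (m.+1.*2 + 0)); last by apply: fil_iter_quad; apply: fil0.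
by rewrite addn0 doubleS -addnn ltnS leqW ?leq_addr.
Qed.

Lemma expqK A a : expq A (expq (- A) a) = a.
Proof. by rewrite -{1}[A]opprK expqNK. Qed.

(** ** Linear change of generators *)

Fact lincomb_is_linear B i : linear (lincomb B i).
Proof.
move=> z a b; rewrite !lincombE scaler_sumr -big_split; apply: eq_bigr => j _ /=.
by rewrite (linearP (t j)) scalerDr !scalerA mulrC.
Qed.
HB.instance Definition _ B i :=
  GRing.isLinear.Build C ext ext *:%R (lincomb B i) (lincomb_is_linear B i).

Lemma lincomb_anticomm (X : {linear ext -> ext}) B i v :
  (forall j u, X (t j u) = - t j (X u)) ->
  X (lincomb B i v) = - lincomb B i (X v).
Proof.
move=> Xt; rewrite !lincombE (linear_sum X) -sumrN; apply: eq_bigr => j _.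
by rewrite (linearZ_LR X) Xt scalerN.
Qed.

(** Congruence of quadratic forms under a substitution of the generators. *)
Lemma quad_lincomb (A B : 'M[C]_m) b :
  quad (lincomb B) A b =
  quad t (B^T *m A *m B) b.
Proof.
rewrite !quadE; congr (_ *: _).
transitivity (\sum_i \sum_j \sum_k \sum_l (A i j * B i k * B j l) *: t k (t l b)).
  apply: eq_bigr => i _; apply: eq_bigr => j _.
  rewrite /= lincombE scaler_sumr; apply: eq_bigr => k _.
  rewrite lincombE (linear_sum (t k)) !scaler_sumr; apply: eq_bigr => l _.
  by rewrite (linearZ_LR (t k)) !scalerA.
transitivity (\sum_k \sum_l \sum_i \sum_j (A i j * B i k * B j l) *: t k (t l b)).
  under eq_bigr => i _ do rewrite exchange_big /=.
  rewrite exchange_big /=; apply: eq_bigr => k _.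
  under eq_bigr => i _ do rewrite exchange_big /=.
  by rewrite exchange_big.
apply: eq_bigr => k _; apply: eq_bigr => l _.
rewrite !mxE scaler_suml exchange_big /=; apply: eq_bigr => j _.
rewrite !mxE mulr_suml scaler_suml; apply: eq_bigr => i _.
by rewrite !mxE; congr (_ *: _); rewrite [B i k * _]mulrC.
Qed.

End QuadExp.

(** * Wedge product and substitution homomorphisms *)

Section WedgeProduct.
Variables (R : realType) (m : nat).
Local Notation C := R[i].
Local Notation ext := (ext R m).
Implicit Types (a b : ext) (i j k : 'I_m).

Definition dx_ i : {linear ext -> ext} := @dxw R m i.
Definition io_ i : {linear ext -> ext} := @iota_ R m i.

Lemma dx_anticomm i j v : dx_ i (dx_ j v) = - dx_ j (dx_ i v).
Proof. exact: dxw_anticomm. Qed.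

Lemma io_anticomm i j v : io_ i (io_ j v) = - io_ j (io_ i v).
Proof. exact: iota_anticomm. Qed.

Lemma ext_wedge1l b : ext_wedge (ext1 R m) b = b.
Proof. exact: (ext_act1 dx_ b). Qed.

Lemma ext_wedge_dxw i a b : ext_wedge (dxw i a) b = dxw i (ext_wedge a b).
Proof. exact: (ext_act_dxw dx_anticomm). Qed.

Fact ext_wedge_is_linear a : linear (ext_wedge a).
Proof. exact: (ext_actPr dx_ a). Qed.
HB.instance Definition _ a :=
  GRing.isLinear.Build C ext ext *:%R (ext_wedge a) (ext_wedge_is_linear a).

Lemma ext_wedge_linl b : linear (fun a => ext_wedge a b).
Proof. exact: (ext_actPl dx_ b). Qed.

Lemma ext_wedge0l b : ext_wedge 0 b = 0.
Proof. exact: (ext_act0l dx_). Qed.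

Lemma ext_wedgeZl z a b : ext_wedge (z *: a) b = z *: ext_wedge a b.
Proof. exact: (ext_actZl dx_). Qed.

Lemma ext_wedge_suml (A : Type) (r : seq A) (P : pred A) (v : A -> ext) b :
  ext_wedge (\sum_(x <- r | P x) v x) b = \sum_(x <- r | P x) ext_wedge (v x) b.
Proof. exact: (ext_act_suml dx_). Qed.

Lemma ext_wedge1r a : ext_wedge a (ext1 R m) = a.
Proof.
elim/ext_ind: a => [z a b Ha Hb||i a Ha].
- by have /= -> := ext_wedge_linl (ext1 R m) z a b; rewrite Ha Hb.
- exact: ext_wedge1l.
- by rewrite ext_wedge_dxw Ha.
Qed.

Lemma ext_wedgeA a b c : ext_wedge (ext_wedge a b) c = ext_wedge a (ext_wedge b c).
Proof.
elim/ext_ind: a => [z a a' Ha Ha'||i a Ha].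
- have /= -> := ext_wedge_linl b z a a'; have /= -> := ext_wedge_linl c z.
  by rewrite Ha Ha'; have /= -> := ext_wedge_linl (ext_wedge b c) z a a'.
- by rewrite !ext_wedge1l.
- by rewrite !ext_wedge_dxw Ha.
Qed.

End WedgeProduct.

(** The algebra endomorphism dx_i |-> \sum_j B_ij dx_j. *)
HB.lock Definition ext_hom (R : realType) (m : nat) (B : 'M[R[i]]_m) (a : ext R m) : ext R m :=
  ext_act (lincomb (@dx_ R m) B) a (ext1 R m).

Section Hom.
Variables (R : realType) (m : nat).
Local Notation C := R[i].
Local Notation ext := (ext R m).
Local Notation dx_ := (@dx_ R m).
Local Notation io_ := (@io_ R m).
Implicit Types (a b : ext) (i j k : 'I_m) (B : 'M[C]_m).

Lemma ext_homE B a : ext_hom B a = ext_act (lincomb dx_ B) a (ext1 R m).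
Proof. by rewrite ext_hom.unlock. Qed.

Lemma lincomb_dx_anticomm (B : 'M[C]_m) i j v :
  lincomb dx_ B i (lincomb dx_ B j v) = - lincomb dx_ B j (lincomb dx_ B i v).
Proof.
rewrite (lincomb_anticomm (X := lincomb dx_ B i)) // => k u.
by rewrite -[LHS]opprK -lincomb_anticomm // => l v'; exact: dx_anticomm.
Qed.

Fact hom_is_linear B : linear (ext_hom B).
Proof. by move=> z a b; rewrite !ext_homE; have /= -> := ext_actPl (lincomb dx_ B) (ext1 R m) z a b. Qed.
HB.instance Definition _ B :=
  GRing.isLinear.Build C ext ext *:%R (ext_hom B) (hom_is_linear B).

Lemma hom1 B : ext_hom B (ext1 R m) = ext1 R m.
Proof. by rewrite ext_homE (ext_act1 (lincomb dx_ B)). Qed.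

Lemma hom_dxw B i a : ext_hom B (dxw i a) = lincomb dx_ B i (ext_hom B a).
Proof. by rewrite !ext_homE (ext_act_dxw (lincomb_dx_anticomm B)). Qed.

Lemma hom_wedge B a b : ext_hom B (ext_wedge a b) = ext_wedge (ext_hom B a) (ext_hom B b).
Proof.
elim/ext_ind: a => [z a a' Ha Ha'||i a Ha].
- have /= -> := ext_wedge_linl b z a a'; rewrite !(linearP (ext_hom B)) /= Ha Ha'.
  by have /= -> := ext_wedge_linl (ext_hom B b) z (ext_hom B a) (ext_hom B a').
- by rewrite hom1 !ext_wedge1l.
- rewrite ext_wedge_dxw !hom_dxw Ha !lincombE.
  rewrite [RHS](ext_wedge_suml _ _ (fun j => B i j *: dx_ j (ext_hom B a))).
  by apply: eq_bigr => j _; rewrite ext_wedgeZl /dx_ /= ext_wedge_dxw.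
Qed.

(** Both sides anticommute with exterior multiplications in the same way, so it is
    enough to compare them on the generators, where they are the entries of [B]. *)
Lemma hom_iota B i a : iota_ i (ext_hom B a) = \sum_j B j i *: ext_hom B (iota_ j a).
Proof.
elim/ext_ind: a => [z a a' Ha Ha'||k a Ha].
- rewrite (linearP (ext_hom B)) (linearP (io_ i)) /io_ /= Ha Ha' scaler_sumr -big_split.
  apply: eq_bigr => j _; rewrite /= (linearP (io_ j)) (linearP (ext_hom B)) scalerDr !scalerA.
  by rewrite [z * _]mulrC.
- rewrite hom1 iota_ext1 big1 // => j _.
  by rewrite iota_ext1 linear0 scaler0.
- have sumD (f : 'I_m -> C) l : \sum_j (f j * (j == l)%:R) *: ext_hom B a = f l *: ext_hom B a.
    rewrite (bigD1 l) //= eqxx mulr1 big1 ?addr0 // => j /negbTE ->.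
    by rewrite mulr0 scale0r.
  transitivity (B k i *: ext_hom B a - lincomb dx_ B k (iota_ i (ext_hom B a))).
    rewrite hom_dxw !lincombE (linear_sum (io_ i)) /= -sumD -sumrB.
    apply: eq_bigr => j _; rewrite (linearZ_LR (io_ i)) /io_ /dx_ /= iota_dxw.
    by rewrite scalerDr scalerN scalerA addrC eq_sym.
  rewrite Ha (linear_sum (lincomb dx_ B k)) /= -(sumD (B^~ i) k) -sumrB.
  apply: eq_bigr => j _; rewrite iota_dxw (linearD (ext_hom B)) /=.
  rewrite (linearN (ext_hom B)) (linearZ_LR (ext_hom B)) (linearZ_LR (lincomb dx_ B k)) /=.
  by rewrite hom_dxw scalerDr scalerN scalerA addrC.
Qed.

Lemma hom_comp B B' a : ext_hom B (ext_hom B' a) = ext_hom (B' *m B) a.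
Proof.
elim/ext_ind: a => [z a a' Ha Ha'||k a Ha].
- rewrite (linearP (ext_hom B')) [LHS](linearP (ext_hom B)).
  by rewrite [RHS](linearP (ext_hom (B' *m B))) /= Ha Ha'.
- by rewrite !hom1.
- rewrite !hom_dxw -Ha !lincombE (linear_sum (ext_hom B)).
  transitivity (\sum_j \sum_l (B' k j * B j l) *: dx_ l (ext_hom B (ext_hom B' a))).
    apply: eq_bigr => j _; rewrite (linearZ_LR (ext_hom B)) /= hom_dxw lincombE scaler_sumr.
    by apply: eq_bigr => l _; rewrite scalerA.
  rewrite exchange_big; apply: eq_bigr => l _; by rewrite !mxE scaler_suml.
Qed.

Lemma hom_id a : ext_hom 1%:M a = a.
Proof.
elim/ext_ind: a => [z a a' Ha Ha'||k a Ha]; first by rewrite (linearP (ext_hom _)) /= Ha Ha'.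
  exact: hom1.
rewrite hom_dxw Ha lincombE (bigD1 k) //= !mxE eqxx scale1r big1 ?addr0 // => j jk.
by rewrite !mxE eq_sym (negbTE jk) scale0r.
Qed.

End Hom.

(** * The isomorphism phi at a point *)

(** The value of phi at a point where the symplectic form is [w]. *)
HB.lock Definition Phi (R : realType) (m : nat) (w a : ext R m) : ext R m :=
  ext_wedge (exp_iw w) (exp_Lambda w a).

Section PointwisePhi.
Variables (R : realType) (m : nat).
Local Notation C := R[i].
Local Notation ext := (ext R m).
Local Notation dx_ := (@dx_ R m).
Local Notation io_ := (@io_ R m).
Local Notation dxA := (@dx_anticomm R m).
Local Notation ioA := (@io_anticomm R m).
Implicit Types (a b : ext) (i j k : 'I_m).

(** The matrix of the bivector w^-1 that defines Lambda. *)
Definition Poisson (w : ext) : 'M[C]_m := (invmx (form_mx w))^T.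
Definition inv_2i : C := (2 * 'i%C)^-1.

Lemma imaginary_neq0 : 'i%C != 0 :> C.
Proof.
apply/eqP => h; have := sqr_i R; rewrite h expr0n /= => /eqP.
by rewrite eq_sym oppr_eq0 oner_eq0.
Qed.

Lemma inv_2i_mul_i : inv_2i * 'i%C = 2^-1.
Proof. by rewrite /inv_2i invfM -mulrA mulVf ?imaginary_neq0 // mulr1. Qed.

Lemma LambdaE w a : Lambda w a = quad io_ (Poisson w) a.
Proof. by rewrite quadE. Qed.

Variable w : ext.
Hypothesis hw : homogeneous 2 w.
Hypothesis uw : form_mx w \in unitmx.

Local Notation W := (form_mx w).
Local Notation P := (Poisson w).
Local Notation E := (expq dx_ ('i%C *: W)).
Local Notation L := (expq io_ (inv_2i *: P)).

Lemma Poisson_mul : P *m W = - 1%:M.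
Proof.
rewrite -[LHS]trmxK trmx_mul trmxK form_mx_antisym mulNmx mulmxV //.
by rewrite linearN /= trmx1.
Qed.

Lemma mul_Poisson : W *m P = - 1%:M.
Proof.
rewrite -[LHS]trmxK trmx_mul trmxK form_mx_antisym mulmxN mulVmx //.
by rewrite linearN /= trmx1.
Qed.

Lemma Poisson_inv : P = - invmx W.
Proof.
by rewrite -[LHS]mulmx1 -(mulmxV uw) mulmxA Poisson_mul mulNmx mul1mx.
Qed.

Lemma Poisson_antisym : P^T = - P.
Proof. by rewrite {1}/Poisson trmxK Poisson_inv opprK. Qed.

Lemma ext_wedge_hom2 b : ext_wedge w b = quad dx_ W b.
Proof. exact: (ext_act_hom2 dxA). Qed.

Lemma exp_iwE b : ext_wedge (exp_iw w) b = E b.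
Proof.
rewrite expqE /exp_iw /exp_op ext_wedge_suml; apply: eq_bigr => n _.
rewrite ext_wedgeZl; congr (_ *: _).
elim: (n : nat) => /= [|p IH]; first by rewrite ext_wedge1l.
by rewrite ext_wedgeA IH ext_wedgeZl ext_wedge_hom2 quadZ.
Qed.

Lemma PhiE a : Phi w a = E (L a).
Proof.
rewrite Phi.unlock exp_iwE; apply: (congr1 (expq dx_ _)); rewrite expqE; apply: eq_exp_op => b.
by rewrite quadZ LambdaE.
Qed.

(** e^(-Lambda/2i) e^(-iw). *)
Definition PhiV b := expq io_ (- (inv_2i *: P)) (expq dx_ (- ('i%C *: W)) b).

Lemma PhiK a : PhiV (Phi w a) = a.
Proof.
by rewrite PhiE /PhiV (expqNK dxA) (expqNK ioA).
Qed.

Lemma PhiVK a : Phi w (PhiV a) = a.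
Proof.
by rewrite PhiE /PhiV (expqK ioA) (expqK dxA).
Qed.

Lemma PhiD a b : Phi w (a + b) = Phi w a + Phi w b.
Proof. by rewrite !PhiE (linearD L) (linearD E). Qed.

Lemma PhiZ z a : Phi w (z *: a) = z *: Phi w a.
Proof. by rewrite !PhiE (linearZ_LR L) (linearZ_LR E). Qed.

Lemma PhiN a : Phi w (- a) = - Phi w a.
Proof. by rewrite -scaleN1r PhiZ scaleN1r. Qed.

Lemma Phi0 : Phi w 0 = 0.
Proof. by rewrite !PhiE (linear0 L) (linear0 E). Qed.

Lemma Phi_sum (A : Type) (r : seq A) (Q : pred A) (v : A -> ext) :
  Phi w (\sum_(x <- r | Q x) v x) = \sum_(x <- r | Q x) Phi w (v x).
Proof.
by rewrite !PhiE (linear_sum L) (linear_sum E); apply: eq_bigr => x _; rewrite PhiE.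
Qed.

Lemma PhiV_sum (A : Type) (r : seq A) (Q : pred A) (v : A -> ext) :
  PhiV (\sum_(x <- r | Q x) v x) = \sum_(x <- r | Q x) PhiV (v x).
Proof. by rewrite /PhiV (linear_sum (expq _ _)) (linear_sum (expq _ _)). Qed.

Lemma PhiVZ z a : PhiV (z *: a) = z *: PhiV a.
Proof. by rewrite /PhiV !expqZ. Qed.

(** The shape of the correction term of [expq_comm] for the Kronecker symbol. *)
Lemma sum_delta1 (A : 'M[C]_m) (f : 'I_m -> ext) k z :
  \sum_i \sum_j (((k == i)%:R * (z *: A) i j)) *: f j = z *: \sum_j A k j *: f j.
Proof.
rewrite (bigD1 k) //= [X in _ + X]big1 ?addr0; last first.
  by move=> i /negbTE ik; rewrite big1 // => j _; rewrite eq_sym ik mul0r scale0r.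
by rewrite scaler_sumr; apply: eq_bigr => j _; rewrite eqxx mul1r mxE scalerA.
Qed.

(** The contraction with the Hamiltonian vector field of the k-th coordinate, which
    is the commutator of dx_k /\ with Lambda. *)
Definition eta k a : ext := lincomb io_ P k a.

(** dx_k commutes with e^(iw), and its commutator with Lambda/2i is eta_k/2i. *)
Lemma dxw_Phi k a : dxw k (Phi w a) = Phi w (dxw k a + inv_2i *: eta k a).
Proof.
rewrite !PhiE -[dxw k (E _)]/(dx_ k (E _)) (expq_comm0 _ _ (dxA k)).
rewrite (expq_comm ioA (X := dx_ k) (s := fun i => (k == i)%:R)).
- by rewrite sum_delta1 /eta lincombE.
- by move=> i v; exact: dxw_iota.
- by rewrite linearZ /= Poisson_antisym scalerN.
Qed.

(** As W P = -1, the [eta j] recombine to a contraction. *)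
Lemma sum_form_eta k a :
  \sum_j W k j *: (inv_2i *: eta j a) = - (inv_2i *: iota_ k a).
Proof.
rewrite /eta; under eq_bigr do rewrite lincombE.
transitivity (\sum_l inv_2i *: ((W *m P) k l *: io_ l a)).
  rewrite [RHS](eq_bigr (fun l => \sum_j (W k j * inv_2i * P j l) *: io_ l a)).
    rewrite [RHS]exchange_big; apply: eq_bigr => j _; rewrite !scaler_sumr.
    by apply: eq_bigr => l _; rewrite !scalerA.
  move=> l _; rewrite mxE scaler_suml scaler_sumr; apply: eq_bigr => j _.
  by rewrite scalerA; congr (_ *: _); rewrite mulrA [inv_2i * _]mulrC.
rewrite mul_Poisson -scaler_sumr (bigD1 k) //= !mxE eqxx big1 ?addr0.
  by rewrite mulr1n scaleN1r scalerN.
by move=> l lk; rewrite !mxE eq_sym (negbTE lk) mulr0n oppr0 scale0r.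
Qed.

(** The commutator of iota_k with e^(iw) is i (iota_k w) /\, and passing this 1-form
    through e^(Lambda/2i) takes away one half of iota_k. *)
Lemma iota_Phi k a : iota_ k (Phi w a) =
  Phi w (2^-1 *: iota_ k a + 'i%C *: \sum_j W k j *: dxw j a).
Proof.
rewrite PhiE -[iota_ k (E _)]/(io_ k (E _)).
rewrite (expq_comm dxA (X := io_ k) (s := fun i => (k == i)%:R)); first last.
- by rewrite linearZ /= form_mx_antisym scalerN.
- by move=> i v; exact: iota_dxw.
rewrite sum_delta1 (expq_comm0 _ _ (ioA k)).
have eL j b : dx_ j (L b) = L (dx_ j b + inv_2i *: eta j b).
  rewrite (expq_comm ioA (X := dx_ j) (s := fun i => (j == i)%:R)).
  - by rewrite sum_delta1 /eta lincombE.
  - by move=> i v; exact: dxw_iota.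
  - by rewrite linearZ /= Poisson_antisym scalerN.
rewrite PhiE; apply: (congr1 (expq dx_ _)).
have -> : \sum_j W k j *: dx_ j (L a) = L (\sum_j W k j *: (dx_ j a + inv_2i *: eta j a)).
  by rewrite (linear_sum L); apply: eq_bigr => j _; rewrite (linearZ_LR L) eL.
set v := \sum_j _; rewrite -[_ *: L v](expqZ io_) -[L _ + L _](expqD io_).
apply: (congr1 (expq io_ _)); rewrite {}/v.
under eq_bigr do rewrite scalerDr.
rewrite big_split /= scalerDr addrCA [RHS]addrC; congr (_ + _).
rewrite sum_form_eta.
rewrite scalerN scalerA -[X in X - _]scale1r -scalerBl; congr (_ *: _).
by rewrite mulrC inv_2i_mul_i; field.
Qed.

End PointwisePhi.

(** * Degrees and the Clifford action *)

Section Degrees.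
Variables (R : realType) (m : nat).
Local Notation C := R[i].
Local Notation ext := (ext R m).
Local Notation dx_ := (@dx_ R m).
Local Notation io_ := (@io_ R m).
Implicit Types (a b : ext) (i j : 'I_m) (k l : int).

Definition homc k a : ext := [ffun I : {set 'I_m} => if #|I|%:Z == k then a I else 0].

Fact homc_is_linear k : linear (homc k).
Proof.
move=> z a b; apply/ffunP => I; rewrite !ffunE.
by case: ifP => _; rewrite ?scaler0 ?addr0.
Qed.
HB.instance Definition _ k :=
  GRing.isLinear.Build C ext ext *:%R (homc k) (homc_is_linear k).

Lemma homc_dxw k i a : homc k (dxw i a) = dxw i (homc (k - 1) a).
Proof.
apply/ffunP => I; rewrite !ffunE.
have [iI|_] := boolP (i \in I); last by rewrite if_same.
rewrite (cardsD1 i I) iI PoszD [RHS]fun_if mulr0.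
by rewrite -[in LHS](inj_eq (addrI (-1))) addKr [-1 + _]addrC.
Qed.

Lemma homc_iota k i a : homc k (iota_ i a) = iota_ i (homc (k + 1) a).
Proof.
apply/ffunP => I; rewrite !ffunE.
have [_|iI] := boolP (i \in I); first by rewrite if_same.
rewrite cardsU1 iI PoszD [RHS]fun_if mulr0.
by rewrite -[in LHS](inj_eq (addrI 1)) [1 + k]addrC.
Qed.

Lemma homc_homc k l a : homc k (homc l a) = if k == l then homc k a else 0.
Proof.
apply/ffunP => I; have [<-|kl] := eqVneq k l; rewrite !ffunE.
  by case: eqP.
by case: eqP => // ->; rewrite (negbTE kl).
Qed.

Lemma homc_ext1 k : homc k (ext1 R m) = (k == 0)%:R *: ext1 R m.
Proof.
apply/ffunP => I; rewrite !ffunE; have [->|I0] := eqVneq I finset.set0.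
  by rewrite cards0 eq_sym; case: eqP; rewrite ?scale1r ?scale0r.
by rewrite if_same scaler0.
Qed.

Lemma sum_homc a : \sum_(j < m.+1) homc j%:Z a = a.
Proof.
apply/ffunP => I; rewrite ext_sumE.
have cI : (#|I| < m.+1)%N by rewrite ltnS (leq_trans (max_card _)) // card_ord.
rewrite (bigD1 (Ordinal cI)) //= ffunE eqxx big1 ?addr0 // => j jI.
rewrite ffunE; case: eqP => // -[e]; case/eqP: jI; exact/val_inj.
Qed.

Lemma homc_out k a : ~~ (0 <= k <= m%:Z) -> homc k a = 0.
Proof.
move=> hk; apply/ffunP => I; rewrite !ffunE; case: eqP => // e.
by case/negP: hk; rewrite -e !lez_nat /= (leq_trans (max_card _)) ?card_ord.
Qed.

Lemma homc_ext_hom (B : 'M[C]_m) k a : homc k (ext_hom B a) = ext_hom B (homc k a).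
Proof.
elim/ext_ind: a k => [z a a' Ha Ha'||i a Ha] k.
- by rewrite (linearP (ext_hom B)) !(linearP (homc k)) (linearP (ext_hom B)) /= Ha Ha'.
- by rewrite hom1 homc_ext1 (linearZ_LR (ext_hom B)) /= hom1.
rewrite homc_dxw !hom_dxw -Ha !lincombE (linear_sum (homc k)); apply: eq_bigr => j _.
by rewrite (linearZ_LR (homc k)) /= homc_dxw.
Qed.

Lemma homc_quad_io A k a : homc k (quad io_ A a) = quad io_ A (homc (k + 2) a).
Proof.
rewrite !quadE (linearZ_LR (homc k)) (linear_sum (homc k)); congr (_ *: _).
apply: eq_bigr => i _; rewrite (linear_sum (homc k)); apply: eq_bigr => j _.
by rewrite (linearZ_LR (homc k)) /= !homc_iota -addrA.
Qed.

(** ** Clifford action of the frame of Lbar *)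

Variable w : ext.
Hypothesis hw : homogeneous 2 w.
Hypothesis uw : form_mx w \in unitmx.
Hypothesis rw : forall I, complex.Im (w I) = 0.

Lemma conjC_real (z : C) : complex.Im z = 0 -> conjc z = z.
Proof. by case: z => x y /= ->; rewrite oppr0. Qed.

Lemma contr_delta i a : contr (delta_mx 0 i) a = iota_ i a.
Proof.
rewrite /contr (bigD1 i) //= mxE !eqxx scale1r big1 ?addr0 // => j ji.
by rewrite mxE (negbTE ji) andbF scale0r.
Qed.

(** As [w] is real, the conjugate of X - i X|w is X + i X|w for real X. *)
Lemma clifford_frame i a : clifford (Lbar_frame w i) a =
  iota_ i a + 'i%C *: \sum_j form_mx w i j *: dxw j a.
Proof.
rewrite /clifford /Lbar_frame /gconj /Lvec /=.
have -> : map_mx (@conjc R) (delta_mx 0 i) = delta_mx 0 i :> 'rV[C]_m.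
  by apply/matrixP => p q; rewrite !mxE; case: (_ && _); rewrite ?conjc1 ?conjc0.
rewrite !contr_delta; congr (_ + _).
have -> : [ffun I => conjc ((- 'i%C *: iota_ i w) I)] = 'i%C *: iota_ i w :> ext.
  apply/ffunP => I; rewrite !ffunE; case: ifP => _; rewrite ?scaler0 ?conjc0 //.
  have cM (x y : C) : conjc (x * y) = conjc x * conjc y := rmorphM (@conjc R) x y.
  have ci : conjc (- 'i%C : C) = 'i%C.
    by apply/eqP; rewrite eq_complex /= !oppr0 opprK !eqxx.
  have ck : conjc (koszul_sign R i I) = koszul_sign R i I.
    by rewrite /koszul_sign (rmorphXn (@conjc R)) (rmorphN1 (@conjc R)).
  suff : conjc (- 'i%C * (koszul_sign R i I * w (i |: I)%SET) : C) =
      'i%C * (koszul_sign R i I * w (i |: I)%SET) by [].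
  by rewrite !cM ci ck (conjC_real (rw _)).
rewrite ext_wedgeZl (iota_hom2 i hw) ext_wedge_suml; congr (_ *: _).
by apply: eq_bigr => j _; rewrite ext_wedgeZl ext_wedge_dxw ext_wedge1l.
Qed.

(** The contractions from [iota_Phi] and from [dxw_Phi] cancel, because 1/2i times i
    is 1/2. *)
Lemma clifford_Phi i a : clifford (Lbar_frame w i) (Phi w a) =
  Phi w (lincomb dx_ ((2 * 'i%C) *: form_mx w) i a).
Proof.
have eS : \sum_j form_mx w i j *: dxw j (Phi w a) =
    Phi w (\sum_j form_mx w i j *: dxw j a - inv_2i R *: iota_ i a).
  transitivity (\sum_j Phi w (form_mx w i j *: (dxw j a + inv_2i R *: eta w j a))).
    by apply: eq_bigr => j _; rewrite dxw_Phi // PhiZ.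
  rewrite -Phi_sum //; apply: (congr1 (Phi w)).
  rewrite -(sum_form_eta uw) -big_split; by apply: eq_bigr => j _; rewrite scalerDr.
rewrite clifford_frame iota_Phi // eS -PhiZ // -PhiD // lincombE; apply: (congr1 (Phi w)).
rewrite scalerBr scalerA [_ * inv_2i R]mulrC inv_2i_mul_i [X in _ + X]addrC addrACA subrr add0r -scalerDl.
rewrite scaler_sumr; apply: eq_bigr => j _.
by rewrite scalerA [in RHS]mxE; congr (_ *: _); ring.
Qed.

Lemma exp_iw_Phi : exp_iw w = Phi w (ext1 R m).
Proof.
rewrite PhiE // -[LHS]ext_wedge1r exp_iwE //; apply: (congr1 (expq _ _)).
rewrite expqE exp_op_fix //= quadE big1 ?scaler0 // => i _; rewrite big1 // => j _.
by rewrite /io_ /= iota_ext1 linear0 scaler0.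
Qed.

Lemma foldr_clifford (s : seq 'I_m) a :
  foldr (fun i => clifford (Lbar_frame w i)) (Phi w a) s =
  Phi w (foldr (lincomb dx_ ((2 * 'i%C) *: form_mx w)) a s).
Proof. by elim: s => //= i s ->; rewrite clifford_Phi. Qed.

End Degrees.

(** * The bundles U^k under phi *)

Section Bundle.
Variables (R : realType) (n : nat).
Local Notation m := (2 * n)%N.
Local Notation C := R[i].
Local Notation ext := (ext R m).
Implicit Types (a b : ext) (i j : 'I_m) (k l : int).
Variable w : ext.
Hypothesis hw : homogeneous 2 w.
Hypothesis uw : form_mx w \in unitmx.
Hypothesis rw : forall I, complex.Im (w I) = 0.

Local Notation B := ((2 * 'i%C) *: form_mx w : 'M[C]_m).

Lemma frame_Phi (J : {set 'I_m}) :
  foldr (fun i => clifford (Lbar_frame w i)) (exp_iw w) (enum J) =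
  Phi w (ext_hom B (extb R J)).
Proof. by rewrite exp_iw_Phi // foldr_clifford // ext_homE ext_act_extb. Qed.

Lemma homc_extb k (J : {set 'I_m}) :
  homc k (extb R J) = (#|J|%:Z == k)%:R *: extb R J.
Proof.
apply/ffunP => I; rewrite !ffunE; have [->|IJ] := eqVneq I J.
  by case: eqP; rewrite ?scale1r ?scale0r.
by rewrite if_same scaler0.
Qed.

(** Products of p of the 1-forms 2i iota_k w have degree p. *)
Lemma Ubundle_sub k a : a \in Ubundle w k -> homc (n%:Z - k) (PhiV w a) = PhiV w a.
Proof.
rewrite /Ubundle; set s := image_mem _ _ => /(@coord_span _ _ _ (in_tuple s)) ->.
rewrite PhiV_sum (linear_sum (homc _)); apply: eq_bigr => i _.
rewrite PhiVZ (linearZ_LR (homc _)); congr (_ *: _).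
have : s`_i \in s by rewrite mem_nth.
case/mapP => J; rewrite mem_enum inE => /eqP kJ ->.
rewrite frame_Phi /= PhiK // homc_ext_hom homc_extb -kJ opprB addrCA subrr addr0 eqxx.
by rewrite scale1r.
Qed.

(** The 1-forms 2i iota_k w are a basis, as [w] is nondegenerate. *)
Lemma ext_hom_surj a : exists b, a = ext_hom B b.
Proof.
exists (ext_hom (invmx B) a); rewrite hom_comp mulVmx ?hom_id //.
by rewrite unitmxZ // unitfE mulf_neq0 ?pnatr_eq0 // imaginary_neq0.
Qed.

(** Products of p of the 1-forms 2i iota_k w span the forms of degree p. *)
Lemma Phi_homc_Ubundle k a : Phi w (homc (n%:Z - k) a) \in Ubundle w k.
Proof.
have [b ->] := ext_hom_surj a.
rewrite homc_ext_hom [b]ext_decomp !linear_sum /= Phi_sum //.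
apply: rpred_sum => J _.
rewrite (linearZ_LR (homc _)) (linearZ_LR (ext_hom B)) PhiZ //; apply: rpredZ.
rewrite /= homc_extb; case: eqP => [kJ|_].
  rewrite scale1r -frame_Phi; apply/memv_span/map_f.
  by rewrite mem_enum inE kJ subKr.
by rewrite scale0r (linear0 (ext_hom B)) Phi0 ?rpred0.
Qed.

(** Phi is injective and carries the grading by the degree to the U^k, hence
    carries components to components; for k outside of [-n, n] both sides vanish. *)
Lemma Uproj_Phi k a : Uproj w k (Phi w a) = Phi w (homc (n%:Z - k) a).
Proof.
rewrite /Uproj; set V := (\sum_l _)%VS.
pose v (l : 'I_m.+1) := sumv_pi V l (Phi w a).
have vU (l : 'I_m.+1) : v l \in Ubundle w (n%:Z - l%:Z) by apply: memv_sum_pi.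
have aV : Phi w a \in V.
  rewrite -[a]sum_homc Phi_sum //; apply: memv_sumr => l _.
  by have := Phi_homc_Ubundle (n%:Z - l%:Z) a; rewrite subKr.
have sv : \sum_l v l = Phi w a by apply: sumv_pi_sum.
have hv (l : 'I_m.+1) : homc l%:Z (PhiV w (v l)) = PhiV w (v l).
  by have := Ubundle_sub (vU l); rewrite subKr.
have av : a = \sum_l PhiV w (v l).
  by rewrite -PhiV_sum sv PhiK.
have vE (l : 'I_m.+1) : v l = Phi w (homc l%:Z a).
  rewrite -[LHS](PhiVK hw); apply: (congr1 (Phi w)).
  rewrite av (linear_sum (homc _)) (bigD1 l) //= hv big1 ?addr0 // => j jl.
  rewrite -hv homc_homc; case: eqP => // -[e].
  by case/eqP: jl; apply/val_inj; exact: esym e.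
have [hk|hk] := boolP (0 <= n%:Z - k <= m%:Z); last first.
  rewrite homc_out // big1 => [|j /eqP jk].
    by rewrite Phi0.
  by case/negP: hk; rewrite -jk subKr !lez_nat /= -ltnS ltn_ord.
case/andP: hk => k0 km; have [p pE] : exists p : nat, n%:Z - k = p%:Z.
  by exists `|n%:Z - k|%N; rewrite gez0_abs.
have pm : (p < m.+1)%N by rewrite ltnS -lez_nat -pE.
rewrite (bigD1 (Ordinal pm)) /=; last by rewrite -pE subKr.
rewrite -/(v _) vE /= pE big1 ?addr0 // => j /andP[/eqP jk /eqP []].
by apply/val_inj => /=; move: pE; rewrite -jk subKr => -[].
Qed.

End Bundle.

(** * Smooth functions *)

Section SmoothFunctions.
Local Open Scope classical_set_scope.
Variables (R : realType) (m : nat) (U : set 'rV[R]_m).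
Hypothesis oU : open U.
Local Notation E := 'rV[R]_m.
Local Notation e_ i := (delta_mx 0 i : E).
Implicit Types (f g : E -> R) (x : E) (s : seq 'I_m) (i : 'I_m).

Lemma near_open (T : Type) (f g : E -> T) x :
  (forall y, U y -> f y = g y) -> U x -> \near x, f x = g x.
Proof.
move=> fg Ux; near=> y; apply: fg; near: y.
exact: open_nbhs_nbhs.
Unshelve. all: by end_near. Qed.

Lemma eq_derive_on f g x i :
  (forall y, U y -> f y = g y) -> U x -> 'D_(e_ i) f x = 'D_(e_ i) g x.
Proof. by move=> fg Ux; apply: near_eq_derive; apply: near_open. Qed.

Lemma eq_iter_partial s f g :
  (forall y, U y -> f y = g y) ->
  forall y, U y -> iter_partial s f y = iter_partial s g y.
Proof.
by move=> fg; elim: s => //= i s IH y Uy; apply: eq_derive_on.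
Qed.

Definition C1_at f x :=
  {for x, continuous f} /\ forall i, derivable f x (e_ i).

(** The derivatives of a product are sums of products, so induction on the list of
    partial derivatives does not apply; induction on their number does, through
    [smooth_uptoS]. *)
Definition smooth_upto (k : nat) f :=
  forall s, (size s <= k)%N -> forall x, U x -> C1_at (iter_partial s f) x.

Lemma smooth_onP f : smooth_on U f <-> forall k, smooth_upto k f.
Proof.
split=> [h k s _ x Ux|h s x Ux]; first exact: h.
exact: (h (size s)).
Qed.

Lemma eq_C1_at f g x :
  (forall y, U y -> f y = g y) -> U x -> C1_at f x -> C1_at g x.
Proof.
move=> fg Ux [cf df]; split=> [|i]; last first.
  exact: (near_eq_derivable (near_open fg Ux) (df i)).
have h : g @ x `=>` f @ x by exact: near_eq_cvg (near_open fg Ux).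
by rewrite /prop_for /continuous_at -(fg _ Ux); exact: cvg_trans h cf.
Qed.

Lemma eq_smooth_upto k f g :
  (forall y, U y -> f y = g y) -> smooth_upto k f -> smooth_upto k g.
Proof.
move=> fg sf s sk x Ux; apply: (eq_C1_at _ Ux (sf s sk x Ux)).
exact: eq_iter_partial.
Qed.

Lemma smooth_uptoS k f : smooth_upto k.+1 f <->
  (forall x, U x -> C1_at f x) /\ forall i, smooth_upto k ('D_(e_ i) f).
Proof.
split=> [h|[h0 h1] s].
  split=> [|i s sk x Ux]; first exact: (h [::]).
  have := h (rcons s i); rewrite size_rcons => /(_ sk x Ux).
  by rewrite /iter_partial foldr_rcons.
case/lastP: s => [|s i]; first by move=> _; apply: h0.
by rewrite size_rcons /iter_partial foldr_rcons; apply: h1.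
Qed.

Lemma smooth_uptoW k f : smooth_upto k.+1 f -> smooth_upto k f.
Proof. by move=> h s sk; apply: h; rewrite leqW. Qed.

Lemma smooth_upto0 f : (forall x, U x -> C1_at f x) -> smooth_upto 0 f.
Proof. by move=> h s; rewrite leqn0 size_eq0 => /eqP ->. Qed.

Lemma smooth_upto_C1 k f x : smooth_upto k f -> U x -> C1_at f x.
Proof. by move=> /(_ [::]) h; apply: h. Qed.

Lemma C1_atD f g x : C1_at f x -> C1_at g x -> C1_at (fun y => f y + g y) x.
Proof.
move=> [cf df] [cg dg]; split=> [|i]; first exact: (cvgD cf cg).
exact: (derivableD (df i) (dg i)).
Qed.

Lemma C1_atM f g x : C1_at f x -> C1_at g x -> C1_at (fun y => f y * g y) x.
Proof.
move=> [cf df] [cg dg]; split=> [|i]; first exact: (cvgM cf cg).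
exact: (derivableM (df i) (dg i)).
Qed.

Lemma C1_atV f x : f x != 0 -> C1_at f x -> C1_at (fun y => (f y)^-1) x.
Proof.
move=> fx [cf df]; split=> [|i]; first exact: (cvgV fx cf).
exact: (derivableV fx (df i)).
Qed.

Lemma smooth_upto_cst k (c : R) : smooth_upto k (fun=> c).
Proof.
elim: k c => [|k IH] c.
  apply: smooth_upto0 => x _; split=> [|i]; first exact: (@cst_continuous _ _ c x).
  exact: derivable_cst.
apply/smooth_uptoS; split=> [x Ux|i]; first exact: smooth_upto_C1 (IH c) Ux.
by apply: eq_smooth_upto (IH 0) => y _; apply/esym; exact: (derive_cst c).
Qed.

Lemma smooth_uptoD k f g :
  smooth_upto k f -> smooth_upto k g -> smooth_upto k (fun y => f y + g y).
Proof.
elim: k f g => [|k IH] f g sf sg.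
  apply: smooth_upto0 => x Ux.
  exact: C1_atD (smooth_upto_C1 sf Ux) (smooth_upto_C1 sg Ux).
apply/smooth_uptoS; split=> [x Ux|i].
  exact: C1_atD (smooth_upto_C1 sf Ux) (smooth_upto_C1 sg Ux).
have [/smooth_uptoS[cf df] /smooth_uptoS[cg dg]] := (sf, sg).
apply: eq_smooth_upto (IH _ _ (df i) (dg i)) => y Uy.
by rewrite (deriveD ((cf y Uy).2 i) ((cg y Uy).2 i)).
Qed.

Lemma smooth_uptoM k f g :
  smooth_upto k f -> smooth_upto k g -> smooth_upto k (fun y => f y * g y).
Proof.
elim: k f g => [|k IH] f g sf sg.
  apply: smooth_upto0 => x Ux.
  exact: C1_atM (smooth_upto_C1 sf Ux) (smooth_upto_C1 sg Ux).
apply/smooth_uptoS; split=> [x Ux|i].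
  exact: C1_atM (smooth_upto_C1 sf Ux) (smooth_upto_C1 sg Ux).
have [/smooth_uptoS[cf df] /smooth_uptoS[cg dg]] := (sf, sg).
have := smooth_uptoD (IH _ _ (smooth_uptoW sf) (dg i)) (IH _ _ (smooth_uptoW sg) (df i)).
apply: eq_smooth_upto => y Uy.
by rewrite (deriveM ((cf y Uy).2 i) ((cg y Uy).2 i)).
Qed.

Lemma smooth_uptoV k f : (forall x, U x -> f x != 0) ->
  smooth_upto k f -> smooth_upto k (fun y => (f y)^-1).
Proof.
move=> f0; elim: k => [|k IH] sf.
  by apply: smooth_upto0 => x Ux; apply: C1_atV (f0 x Ux) (smooth_upto_C1 sf Ux).
apply/smooth_uptoS; split=> [x Ux|i].
  exact: C1_atV (f0 x Ux) (smooth_upto_C1 sf Ux).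
have /smooth_uptoS[cf df] := sf.
have sV := IH (smooth_uptoW sf).
have := smooth_uptoM (@smooth_upto_cst k (-1)) (smooth_uptoM (smooth_uptoM sV sV) (df i)).
apply: eq_smooth_upto => y Uy; rewrite (deriveV (f0 y Uy) ((cf y Uy).2 i)).
by rewrite mulN1r -[RHS]/(- (f y) ^- 2 * _) mulNr expr2 invfM.
Qed.

Lemma eq_smooth_on f g :
  (forall y, U y -> f y = g y) -> smooth_on U f -> smooth_on U g.
Proof. by move=> fg /smooth_onP h; apply/smooth_onP => k; apply: eq_smooth_upto fg (h k). Qed.

Lemma smooth_on_cst (c : R) : smooth_on U (fun=> c).
Proof. by apply/smooth_onP => k; apply: smooth_upto_cst. Qed.

Lemma smooth_onD f g : smooth_on U f -> smooth_on U g ->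
  smooth_on U (fun y => f y + g y).
Proof.
by move=> /smooth_onP hf /smooth_onP hg; apply/smooth_onP => k; apply: smooth_uptoD.
Qed.

Lemma smooth_onM f g : smooth_on U f -> smooth_on U g ->
  smooth_on U (fun y => f y * g y).
Proof.
by move=> /smooth_onP hf /smooth_onP hg; apply/smooth_onP => k; apply: smooth_uptoM.
Qed.

Lemma smooth_onV f : (forall x, U x -> f x != 0) -> smooth_on U f ->
  smooth_on U (fun y => (f y)^-1).
Proof. by move=> f0 /smooth_onP hf; apply/smooth_onP => k; apply: smooth_uptoV. Qed.

Lemma smooth_onN f : smooth_on U f -> smooth_on U (fun y => - f y).
Proof.
move=> sf; apply: eq_smooth_on (smooth_onM (smooth_on_cst (-1)) sf) => y _.
by rewrite mulN1r.
Qed.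

Lemma smooth_on_C1 f x : smooth_on U f -> U x -> C1_at f x.
Proof. by move=> /smooth_onP/(_ 0%N); apply: smooth_upto_C1. Qed.

(** ** Complex-valued functions *)

Implicit Types F G : E -> R[i].

Lemma eq_smooth_onC F G : (forall y, U y -> F y = G y) ->
  smooth_onC U F -> smooth_onC U G.
Proof.
by move=> FG [sr si]; split; [apply: eq_smooth_on sr|apply: eq_smooth_on si]
  => y Uy; rewrite FG.
Qed.

Lemma smooth_onC_cst (c : R[i]) : smooth_onC U (fun=> c).
Proof. by split; apply: smooth_on_cst. Qed.

Lemma smooth_onCD F G : smooth_onC U F -> smooth_onC U G ->
  smooth_onC U (fun y => F y + G y).
Proof.
move=> [Fr Fi] [Gr Gi]; split.
  by apply: eq_smooth_on (smooth_onD Fr Gr) => y _; case: (F y) (G y) => ? ? [].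
by apply: eq_smooth_on (smooth_onD Fi Gi) => y _; case: (F y) (G y) => ? ? [].
Qed.

Lemma smooth_onCM F G : smooth_onC U F -> smooth_onC U G ->
  smooth_onC U (fun y => F y * G y).
Proof.
move=> [Fr Fi] [Gr Gi]; split.
  apply: eq_smooth_on (smooth_onD (smooth_onM Fr Gr) (smooth_onN (smooth_onM Fi Gi))) => y _.
  by case: (F y) (G y) => ? ? [].
apply: eq_smooth_on (smooth_onD (smooth_onM Fr Gi) (smooth_onM Fi Gr)) => y _.
by case: (F y) (G y) => ? ? [].
Qed.

Lemma smooth_onCV F : (forall x, U x -> F x != 0) -> smooth_onC U F ->
  smooth_onC U (fun y => (F y)^-1).
Proof.
move=> F0 [Fr Fi].
have sN := smooth_onD (smooth_onM Fr Fr) (smooth_onM Fi Fi).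
have /smooth_onV/(_ sN) sV : forall x, U x ->
    complex.Re (F x) * complex.Re (F x) + complex.Im (F x) * complex.Im (F x) != 0.
  move=> x /F0; apply: contra_neq; case: (F x) => a b /= /eqP.
  rewrite -!expr2 paddr_eq0 ?sqr_ge0 // !sqrf_eq0 => /andP[/eqP -> /eqP ->].
  by [].
split.
  by apply: eq_smooth_on (smooth_onM Fr sV) => y _; case: (F y).
apply: eq_smooth_on (smooth_onN (smooth_onM Fi sV)) => y _; case: (F y) => a b /=.
by rewrite -!expr2 ?mulNr.
Qed.

Lemma smooth_onC_sum (I : Type) (r : seq I) (P : pred I) (F : I -> E -> R[i]) :
  (forall z, smooth_onC U (F z)) -> smooth_onC U (fun y => \sum_(z <- r | P z) F z y).
Proof.
move=> sF; elim: r => [|i r IH].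
  by apply: eq_smooth_onC (smooth_onC_cst 0) => y _; rewrite big_nil.
case Pi : (P i); last by apply: eq_smooth_onC IH => y _; rewrite big_cons Pi.
by apply: eq_smooth_onC (smooth_onCD (sF i) IH) => y _; rewrite big_cons Pi.
Qed.

Lemma smooth_onC_prod (I : Type) (r : seq I) (P : pred I) (F : I -> E -> R[i]) :
  (forall z, smooth_onC U (F z)) -> smooth_onC U (fun y => \prod_(z <- r | P z) F z y).
Proof.
move=> sF; elim: r => [|i r IH].
  by apply: eq_smooth_onC (smooth_onC_cst 1) => y _; rewrite big_nil.
case Pi : (P i); last by apply: eq_smooth_onC IH => y _; rewrite big_cons Pi.
by apply: eq_smooth_onC (smooth_onCM (sF i) IH) => y _; rewrite big_cons Pi.
Qed.

(** ** Partial derivatives *)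

Lemma eq_partialC F G i x : (forall y, U y -> F y = G y) -> U x ->
  partialC i F x = partialC i G x.
Proof.
move=> FG Ux; rewrite /partialC; congr (_ +i* _)%C;
by apply: eq_derive_on Ux => y Uy; rewrite FG.
Qed.

Lemma partialC_cst c i x : partialC i (fun=> c) x = 0.
Proof. by rewrite /partialC !derive_cst. Qed.

Lemma partialCD F G i x : smooth_onC U F -> smooth_onC U G -> U x ->
  partialC i (fun y => F y + G y) x = partialC i F x + partialC i G x.
Proof.
move=> [Fr Fi] [Gr Gi] Ux; rewrite /partialC.
have ReD : (fun y => complex.Re (F y + G y)) =
    (fun y => complex.Re (F y)) + (fun y => complex.Re (G y)).
  by apply/funext => y; rewrite /= -[RHS]/(_ + _); case: (F y) (G y) => ? ? [].
have ImD : (fun y => complex.Im (F y + G y)) =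
    (fun y => complex.Im (F y)) + (fun y => complex.Im (G y)).
  by apply/funext => y; rewrite /= -[RHS]/(_ + _); case: (F y) (G y) => ? ? [].
rewrite ReD ImD !deriveD //; by [apply: (smooth_on_C1 _ Ux).2].
Qed.

Lemma partialC_sum (J : Type) (r : seq J) (H : J -> E -> R[i]) i x :
    (forall z, smooth_onC U (H z)) -> U x ->
  partialC i (fun y => \sum_(z <- r) H z y) x = \sum_(z <- r) partialC i (H z) x.
Proof.
move=> sH Ux; elim: r => [|z r IH].
  rewrite (eq_partialC (G := fun=> 0)) //; first by rewrite partialC_cst big_nil.
  by move=> y _; rewrite big_nil.
rewrite (eq_partialC (G := fun y => H z y + \sum_(z <- r) H z y)) //; last first.
  by move=> y _; rewrite big_cons.
by rewrite partialCD ?IH ?big_cons //; exact: smooth_onC_sum.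
Qed.

Lemma partialCM F G i x : smooth_onC U F -> smooth_onC U G -> U x ->
  partialC i (fun y => F y * G y) x = partialC i F x * G x + F x * partialC i G x.
Proof.
move=> [Fr Fi] [Gr Gi] Ux; rewrite /partialC.
have ReM : (fun y => complex.Re (F y * G y)) =
    (fun y => complex.Re (F y)) * (fun y => complex.Re (G y)) -
    (fun y => complex.Im (F y)) * (fun y => complex.Im (G y)).
  by apply/funext => y; rewrite /= -[RHS]/(_ * _ - _ * _); case: (F y) (G y) => ? ? [].
have ImM : (fun y => complex.Im (F y * G y)) =
    (fun y => complex.Re (F y)) * (fun y => complex.Im (G y)) +
    (fun y => complex.Im (F y)) * (fun y => complex.Re (G y)).
  by apply/funext => y; rewrite /= -[RHS]/(_ * _ + _ * _); case: (F y) (G y) => ? ? [].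
have dFr := (smooth_on_C1 Fr Ux).2 i; have dFi := (smooth_on_C1 Fi Ux).2 i.
have dGr := (smooth_on_C1 Gr Ux).2 i; have dGi := (smooth_on_C1 Gi Ux).2 i.
rewrite ReM ImM (deriveB (derivableM dFr dGr) (derivableM dFi dGi)).
rewrite (deriveD (derivableM dFr dGi) (derivableM dFi dGr)).
rewrite (deriveM dFr dGr) (deriveM dFi dGi) (deriveM dFr dGi) (deriveM dFi dGr).
rewrite -![_ *: _]/(_ * _).
move: ('D_(e_ i) _ x) ('D_(e_ i) _ x) ('D_(e_ i) _ x) ('D_(e_ i) _ x) => p q r s.
case: (F x) (G x) => a b [c d]; apply/eqP; rewrite eq_complex /=.
by apply/andP; split; apply/eqP; ring.
Qed.

End SmoothFunctions.

(** * Smooth families of forms and operators *)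

HB.lock Definition dpart (R : realType) (m : nat) (i : 'I_m) (f : 'rV[R]_m -> ext R m)
    (x : 'rV[R]_m) : ext R m :=
  [ffun I => partialC i (fun y => f y I) x].

Section SmoothForms.
Local Open Scope classical_set_scope.
Variables (R : realType) (m : nat) (U : set 'rV[R]_m).
Hypothesis oU : open U.
Local Notation E := 'rV[R]_m.
Local Notation C := R[i].
Local Notation ext := (ext R m).
Implicit Types (f g w : E -> ext) (A B : E -> 'M[C]_m) (x y : E) (i j k : 'I_m).

Definition smooth_ext f := forall I, smooth_onC U (fun x => f x I).
Definition smooth_mx A := forall i j, smooth_onC U (fun x => A x i j).

Definition dmx i A x : 'M[C]_m := \matrix_(p, q) partialC i (fun y => A y p q) x.

Lemma dpartE i f x I : dpart i f x I = partialC i (fun y => f y I) x.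
Proof. by rewrite dpart.unlock ffunE. Qed.

Lemma eq_smooth_ext f g : (forall y, U y -> f y = g y) ->
  smooth_ext f -> smooth_ext g.
Proof. by move=> fg sf I; apply: eq_smooth_onC (sf I) => // y Uy; rewrite fg. Qed.

Lemma eq_dpart i f g x : (forall y, U y -> f y = g y) -> U x ->
  dpart i f x = dpart i g x.
Proof.
move=> fg Ux; apply/ffunP => I; rewrite !dpartE.
by apply: (eq_partialC oU) => // y Uy; rewrite fg.
Qed.

Lemma smooth_ext_cst a : smooth_ext (fun=> a).
Proof. by move=> I; apply: smooth_onC_cst. Qed.

Lemma dpart_cst i a x : dpart i (fun=> a) x = 0.
Proof. by apply/ffunP => I; rewrite dpartE partialC_cst ffunE. Qed.

Lemma smooth_extD f g : smooth_ext f -> smooth_ext g ->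
  smooth_ext (fun y => f y + g y).
Proof.
move=> sf sg I; apply: eq_smooth_onC (smooth_onCD oU (sf I) (sg I)) => // y _.
by rewrite ffunE.
Qed.

Lemma dpartD i f g x : smooth_ext f -> smooth_ext g -> U x ->
  dpart i (fun y => f y + g y) x = dpart i f x + dpart i g x.
Proof.
move=> sf sg Ux; apply/ffunP => I; rewrite ffunE !dpartE -(partialCD i (sf I) (sg I) Ux).
by apply: (congr1 (fun F => partialC i F x)); apply/funext => y; rewrite ffunE.
Qed.

Lemma smooth_extZ (c : E -> C) f : smooth_onC U c -> smooth_ext f ->
  smooth_ext (fun y => c y *: f y).
Proof.
move=> sc sf I; apply: eq_smooth_onC (smooth_onCM oU sc (sf I)) => // y _.
by rewrite ffunE.
Qed.

Lemma dpartZ i (c : E -> C) f x : smooth_onC U c -> smooth_ext f -> U x ->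
  dpart i (fun y => c y *: f y) x = partialC i c x *: f x + c x *: dpart i f x.
Proof.
move=> sc sf Ux; apply/ffunP => I; rewrite ffunE dpartE !extZE dpartE.
rewrite -(partialCM i sc (sf I) Ux).
by apply: (congr1 (fun F => partialC i F x)); apply/funext => y; rewrite extZE.
Qed.

Lemma smooth_dpart_sum (J : Type) (r : seq J) (F : J -> E -> ext) :
    (forall z, smooth_ext (F z)) ->
  smooth_ext (fun y => \sum_(z <- r) F z y) /\
  forall i x, U x -> dpart i (fun y => \sum_(z <- r) F z y) x = \sum_(z <- r) dpart i (F z) x.
Proof.
move=> sF; elim: r => [|z r [sr dr]].
  have e y : 0 = \sum_(z <- [::]) F z y by rewrite big_nil.
  split=> [|i x Ux]; first by apply: eq_smooth_ext (smooth_ext_cst 0) => y _; exact: e.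
  by rewrite -(@eq_dpart i (fun=> 0)) // dpart_cst big_nil.
have e y : F z y + \sum_(z <- r) F z y = \sum_(z <- z :: r) F z y by rewrite big_cons.
split=> [|i x Ux]; first by apply: eq_smooth_ext (smooth_extD (sF z) sr) => y _; exact: e.
by rewrite -(@eq_dpart i (fun y => F z y + \sum_(z <- r) F z y)) // dpartD // dr // big_cons.
Qed.

Lemma smooth_ext_sum (J : Type) (r : seq J) (F : J -> E -> ext) :
  (forall z, smooth_ext (F z)) -> smooth_ext (fun y => \sum_(z <- r) F z y).
Proof. by move=> sF; have [] := smooth_dpart_sum r sF. Qed.

Lemma dpart_sum (J : Type) (r : seq J) (F : J -> E -> ext) i x :
  (forall z, smooth_ext (F z)) -> U x ->
  dpart i (fun y => \sum_(z <- r) F z y) x = \sum_(z <- r) dpart i (F z) x.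
Proof. by move=> sF; have [_] := smooth_dpart_sum r sF; apply. Qed.

(** A linear operator has constant coefficients in the basis of the dx_I, hence
    preserves smoothness and commutes with partial derivatives. *)
Lemma linear_extb (T : {linear ext -> ext}) a : T a = \sum_J a J *: T (extb R J).
Proof.
rewrite {1}[a]ext_decomp (linear_sum T); apply: eq_bigr => J _.
by rewrite (linearZ_LR T).
Qed.

Lemma smooth_ext_linear (T : {linear ext -> ext}) f :
  smooth_ext f -> smooth_ext (fun y => T (f y)).
Proof.
move=> sf; apply: (@eq_smooth_ext (fun y => \sum_J f y J *: T (extb R J))).
  by move=> y _; rewrite [RHS]linear_extb.
apply: smooth_ext_sum => J; apply: smooth_extZ (sf J) _; exact: smooth_ext_cst.
Qed.

Lemma dpart_linear (T : {linear ext -> ext}) i f x : smooth_ext f -> U x ->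
  dpart i (fun y => T (f y)) x = T (dpart i f x).
Proof.
move=> sf Ux; rewrite (@eq_dpart _ _ (fun y => \sum_J f y J *: T (extb R J))) //; last first.
  by move=> y _; rewrite [LHS]linear_extb.
have sJ J : smooth_ext (fun y => f y J *: T (extb R J)).
  by apply: smooth_extZ (sf J) _; exact: smooth_ext_cst.
rewrite (dpart_sum _ i sJ Ux).
rewrite [RHS]linear_extb; apply: eq_bigr => J _.
by rewrite (dpartZ i (sf J) (smooth_ext_cst _) Ux) dpart_cst scaler0 addr0 dpartE.
Qed.

(** ** Quadratic operators with variable coefficients *)

Section VariableQuad.
Variable t : 'I_m -> {linear ext -> ext}.
Hypothesis tA : forall i j v, t i (t j v) = - t j (t i v).

Let qterm A f i j y := A y i j *: t i (t j (f y)).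

Let smooth_qterm A f i j : smooth_mx A -> smooth_ext f -> smooth_ext (qterm A f i j).
Proof.
move=> sA sf; apply: smooth_extZ (sA i j) _.
by do 2!apply: smooth_ext_linear.
Qed.

Lemma smooth_quad A f : smooth_mx A -> smooth_ext f ->
  smooth_ext (fun y => quad t (A y) (f y)).
Proof.
move=> sA sf.
apply: (@eq_smooth_ext (fun y => 2^-1 *: \sum_i \sum_j qterm A f i j y)).
  by move=> y _; rewrite quadE.
apply: (@smooth_extZ (fun=> 2^-1)); first exact: smooth_onC_cst.
apply: smooth_ext_sum => i; apply: smooth_ext_sum => j; exact: smooth_qterm.
Qed.

Lemma dpart_quad A f k x : smooth_mx A -> smooth_ext f -> U x ->
  dpart k (fun y => quad t (A y) (f y)) x =
  quad t (A x) (dpart k f x) + quad t (dmx k A x) (f x).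
Proof.
move=> sA sf Ux.
rewrite (@eq_dpart _ _ (fun y => 2^-1 *: \sum_i \sum_j qterm A f i j y)) //; last first.
  by move=> y _; rewrite quadE.
have s1 i : smooth_ext (fun y => \sum_j qterm A f i j y).
  by apply: smooth_ext_sum => j; apply: smooth_qterm.
rewrite (@dpartZ _ (fun=> 2^-1)) //; [|exact: smooth_onC_cst|exact: smooth_ext_sum].
rewrite partialC_cst scale0r add0r !quadE -scalerDr; congr (_ *: _).
rewrite (dpart_sum _ k s1 Ux) -big_split; apply: eq_bigr => i _ /=.
rewrite (dpart_sum _ k (fun j => smooth_qterm i j sA sf) Ux).
rewrite -big_split; apply: eq_bigr => j _ /=.
have s2 : smooth_ext (fun y => t j (f y)) by apply: smooth_ext_linear.
have s3 : smooth_ext (fun y => t i (t j (f y))) by apply: smooth_ext_linear.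
rewrite (dpartZ k (sA i j) s3 Ux) (dpart_linear (t i) k s2 Ux).
by rewrite (dpart_linear (t j) k sf Ux) addrC mxE.
Qed.

Lemma smooth_iter_quad A f n : smooth_mx A -> smooth_ext f ->
  smooth_ext (fun y => iter n (quad t (A y)) (f y)).
Proof. by move=> sA sf; elim: n => [|n IH]; [exact: sf|exact: smooth_quad sA IH]. Qed.

Lemma smooth_expq A f : smooth_mx A -> smooth_ext f ->
  smooth_ext (fun y => expq t (A y) (f y)).
Proof.
move=> sA sf.
apply: (@eq_smooth_ext (fun y => \sum_(n < m.+1) (n`!%:R)^-1 *: iter n (quad t (A y)) (f y))).
  by move=> y _; rewrite expqE.
apply: smooth_ext_sum => n; apply: (@smooth_extZ (fun=> (n`!%:R)^-1)).
  exact: smooth_onC_cst.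
exact: smooth_iter_quad.
Qed.

(** The derivative of the exponent is again quadratic in the [t i], so it commutes
    with the exponent. *)
Lemma dpart_expq A f k x : smooth_mx A -> smooth_ext f -> U x ->
  dpart k (fun y => expq t (A y) (f y)) x =
  expq t (A x) (dpart k f x + quad t (dmx k A x) (f x)).
Proof.
move=> sA sf Ux.
rewrite (@eq_dpart _ _
  (fun y => \sum_(n < m.+1) (n`!%:R)^-1 *: iter n (quad t (A y)) (f y))) //; last first.
  by move=> y _; rewrite expqE.
have sn (n : 'I_m.+1) : smooth_ext (fun y => (n`!%:R)^-1 *: iter n (quad t (A y)) (f y)).
  apply: (@smooth_extZ (fun=> (n`!%:R)^-1)); first exact: smooth_onC_cst.
  exact: smooth_iter_quad.
rewrite (dpart_sum _ k sn Ux) expqE -(exp_op_leibniz (u := fun n => dpart k (fun y => iter n (quad t (A y)) (f y)) x)).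
- apply: eq_bigr => n _; rewrite (@dpartZ _ (fun=> (n`!%:R)^-1)) //.
  + by rewrite partialC_cst scale0r add0r.
  + exact: smooth_onC_cst.
  + exact: smooth_iter_quad.
- elim=> [|n IH]; first by rewrite mulr0n addr0.
  rewrite /= (@dpart_quad A (fun y => iter n (quad t (A y)) (f y))) //; last first.
    exact: smooth_iter_quad.
  rewrite IH (linearD (quad t (A x))) /= (linearMn (quad t (A x))) -addrA.
  congr (_ + _).
  have -> : quad t (dmx k A x) (iter n (quad t (A x)) (f x)) =
      iter n (quad t (A x)) (quad t (dmx k A x) (f x)).
    by elim: n {IH} => //= n <-; exact: quad_quad.
  case: n {IH} => [|n]; first by rewrite mulr0n add0r.
  by rewrite /= [in RHS]mulrSr.
- apply: (@fil_eq0 _ _ t (m.*2 + 2)); first by rewrite addn2 -addnn ltnS leqW ?leq_addr.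
  by apply: fil_iter_quad; apply: fil_quad; apply: fil0.
Qed.

End VariableQuad.

End SmoothForms.

(** * The Poisson bivector of a closed form *)

Section ExteriorDerivative.
Local Open Scope classical_set_scope.
Variables (R : realType) (m : nat) (U : set 'rV[R]_m).
Hypothesis oU : open U.
Local Notation E := 'rV[R]_m.
Local Notation C := R[i].
Local Notation ext := (ext R m).
Local Notation io_ := (@io_ R m).
Local Notation ioA := (@io_anticomm R m).
Implicit Types (f g w : E -> ext) (A B : E -> 'M[C]_m) (x y : E) (i j k : 'I_m).
Local Notation smooth_ext := (smooth_ext U).
Local Notation smooth_mx := (smooth_mx U).

Lemma eq_smooth_mx A B : (forall y, U y -> A y = B y) -> smooth_mx A -> smooth_mx B.
Proof.
by move=> AB sA i j; apply: eq_smooth_onC (sA i j) => // y Uy; rewrite AB.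
Qed.

Lemma smooth_mxZ z A : smooth_mx A -> smooth_mx (fun y => z *: A y).
Proof.
move=> sA i j; apply: eq_smooth_onC (smooth_onCM oU (smooth_onC_cst oU z) (sA i j)) => // y _.
by rewrite mxE.
Qed.

Lemma dmxZ k z A x : smooth_mx A -> U x ->
  dmx k (fun y => z *: A y) x = z *: dmx k A x.
Proof.
move=> sA Ux; apply/matrixP => i j; rewrite !mxE.
rewrite (eq_partialC oU (G := fun y => z * A y i j)) //; last by move=> y _; rewrite mxE.
by rewrite (partialCM k (smooth_onC_cst oU z) (sA i j) Ux) partialC_cst mul0r add0r.
Qed.

Lemma smooth_det p (D : E -> 'M[C]_p) :
    (forall q r, smooth_onC U (fun y => D y q r)) ->
  smooth_onC U (fun y => \det (D y)).
Proof.
move=> sA; apply: smooth_onC_sum => // s.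
apply: (smooth_onCM oU); first exact: smooth_onC_cst.
by apply: smooth_onC_prod => // i; exact: sA.
Qed.
(** By Cramer's rule. *)
Lemma smooth_invmx A : (forall y, U y -> A y \in unitmx) -> smooth_mx A ->
  smooth_mx (fun y => invmx (A y)).
Proof.
move=> uA sA; apply: (@eq_smooth_mx (fun y => (\det (A y))^-1 *: \adj (A y))).
  by move=> y Uy; rewrite /invmx uA.
move=> i j; apply: (eq_smooth_onC oU (F := fun y => (\det (A y))^-1 * cofactor (A y) j i)).
  by move=> y _; rewrite !mxE.
apply: (smooth_onCM oU).
  apply: (smooth_onCV oU); last exact: smooth_det.
  by move=> y Uy; have := uA y Uy; rewrite unitmxE unitfE.
apply: (smooth_onCM oU); first exact: smooth_onC_cst.
apply: smooth_det => // p q; rewrite /row' /col'.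
apply: (eq_smooth_onC oU (F := fun y => A y (lift j p) (lift i q))); last exact: sA.
by move=> y _; rewrite !mxE.
Qed.

Lemma dmx_mul k A B x : smooth_mx A -> smooth_mx B -> U x ->
  dmx k (fun y => A y *m B y) x = dmx k A x *m B x + A x *m dmx k B x.
Proof.
move=> sA sB Ux; apply/matrixP => i j; rewrite !mxE.
rewrite (eq_partialC oU (G := fun y => \sum_l A y i l * B y l j)) //; last first.
  by move=> y _; rewrite mxE.
rewrite (partialC_sum oU _ k (fun l => smooth_onCM oU (sA i l) (sB l j)) Ux).
rewrite -big_split; apply: eq_bigr => l _ /=.
by rewrite (partialCM k (sA i l) (sB l j) Ux) !mxE.
Qed.

Lemma smooth_form_mx w : smooth_ext w -> smooth_mx (fun y => form_mx (w y)).
Proof.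
move=> sw i j.
apply: (eq_smooth_onC oU (F := fun y => io_ j (io_ i (w y)) finset.set0)).
  by move=> y _; rewrite mxE.
by have := smooth_ext_linear oU (io_ j) (smooth_ext_linear oU (io_ i) sw); apply.
Qed.

Lemma dmx_form_mx k w x : smooth_ext w -> U x ->
  dmx k (fun y => form_mx (w y)) x = form_mx (dpart k w x).
Proof.
move=> sw Ux; apply/matrixP => i j; rewrite !mxE.
have si := smooth_ext_linear oU (io_ i) sw.
have := dpart_linear oU (io_ j) k si Ux; rewrite (dpart_linear oU (io_ i) k sw Ux).
move/(congr1 (fun a : ext => a finset.set0)); rewrite dpartE => <-.
by apply: (eq_partialC oU) => // y _; rewrite mxE.
Qed.

Lemma homogeneous_dpart p k w x :
  (forall y, U y -> homogeneous p (w y)) -> U x -> homogeneous p (dpart k w x).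
Proof.
move=> hw Ux; apply/homogeneousP => I Ip; rewrite dpartE.
rewrite (eq_partialC oU (G := fun=> 0)) ?partialC_cst // => y Uy.
by have /homogeneousP -> := hw y Uy.
Qed.

Section Symplectic.
Variable w : E -> ext.
Hypothesis sw : smooth_ext w.
Hypothesis hw : forall y, U y -> homogeneous 2 (w y).
Hypothesis uw : forall y, U y -> form_mx (w y) \in unitmx.
Hypothesis dw : forall y, U y -> ext_d w y = 0.

Local Notation P := (fun y => Poisson (w y)).

Lemma ext_dE f x : ext_d f x = \sum_k dxw k (dpart k f x).
Proof.
by apply: eq_bigr => k _; congr dxw; apply/ffunP => I; rewrite dpartE ffunE.
Qed.

Lemma smooth_Poisson : smooth_mx P.
Proof.
move=> i j; apply: (eq_smooth_onC oU (F := fun y => invmx (form_mx (w y)) j i)).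
  by move=> y _; rewrite mxE.
exact: (smooth_invmx uw (smooth_form_mx sw)).
Qed.

(** Differentiate W P = -1. *)
Lemma dmx_Poisson k x : U x ->
  dmx k P x = P x *m form_mx (dpart k w x) *m P x.
Proof.
move=> Ux; have sP := smooth_Poisson; have sW := smooth_form_mx sw.
have : dmx k (fun y => form_mx (w y) *m P y) x = 0.
  apply/matrixP => i j; rewrite !mxE.
  rewrite (eq_partialC oU (G := fun=> (- 1%:M) i j)) ?partialC_cst // => y Uy.
  by rewrite mul_Poisson // uw.
rewrite dmx_mul // dmx_form_mx // => /eqP; rewrite addrC addr_eq0 => /eqP e.
rewrite -mulmxA -[_ *m P x]opprK -e mulmxN mulmxA Poisson_mul ?uw //.
by rewrite mulNmx mul1mx opprK.
Qed.

(** The Jacobi identity for the bivector w^-1: by [dmx_Poisson] the sum is, up to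
    sign, the image of dw under the homomorphism that sends dx_k to [eta k]. *)
Lemma sum_eta_quad_dPoisson x a : U x ->
  \sum_k eta (w x) k (quad io_ (dmx k P x) a) = 0.
Proof.
move=> Ux.
have etaA i j v : lincomb io_ (P x) i (lincomb io_ (P x) j v) =
    - lincomb io_ (P x) j (lincomb io_ (P x) i v).
  rewrite (lincomb_anticomm (X := lincomb io_ (P x) i)) // => k u.
  by rewrite -[LHS]opprK -lincomb_anticomm // => l v'; exact: ioA.
transitivity (- ext_act (lincomb io_ (P x)) (ext_d w x) a); last first.
  by rewrite dw // ext_act0l oppr0.
rewrite ext_dE ext_act_suml -sumrN; apply: eq_bigr => k _.
rewrite (ext_act_dxw etaA) -(linearN (lincomb io_ (P x) k)).
apply: (congr1 (lincomb io_ (P x) k)).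
rewrite (ext_act_hom2 etaA) ?quad_lincomb; last exact: homogeneous_dpart.
by rewrite dmx_Poisson // Poisson_antisym ?uw // !mulNmx quadN opprK.
Qed.

End Symplectic.

End ExteriorDerivative.

(** * Exterior derivative of phi *)

Section DPhi.
Local Open Scope classical_set_scope.
Variables (R : realType) (m : nat) (U : set 'rV[R]_m).
Hypothesis oU : open U.
Local Notation E := 'rV[R]_m.
Local Notation C := R[i].
Local Notation ext := (ext R m).
Local Notation dx_ := (@dx_ R m).
Local Notation io_ := (@io_ R m).
Local Notation dxA := (@dx_anticomm R m).
Local Notation ioA := (@io_anticomm R m).
Local Notation inv_2i := (inv_2i R).
Implicit Types (f g : E -> ext) (x y : E) (i j k : 'I_m).
Variable w : E -> ext.
Hypothesis sw : smooth_ext U w.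
Hypothesis hw : forall y, U y -> homogeneous 2 (w y).
Hypothesis uw : forall y, U y -> form_mx (w y) \in unitmx.

Local Notation P := (fun y => Poisson (w y)).
Local Notation Eq x := (expq dx_ ('i%C *: form_mx (w x))).
Local Notation Lq x := (expq io_ (inv_2i *: Poisson (w x))).

Let sE : smooth_mx U (fun y => 'i%C *: form_mx (w y)).
Proof. exact: smooth_mxZ (smooth_form_mx oU sw). Qed.

Let sL : smooth_mx U (fun y => inv_2i *: P y).
Proof. exact: smooth_mxZ (smooth_Poisson oU sw uw). Qed.

Lemma smooth_Phi f : smooth_ext U f -> smooth_ext U (fun y => Phi (w y) (f y)).
Proof.
move=> sf; apply: (eq_smooth_ext oU (f := fun y => Eq y (Lq y (f y)))).
  by move=> y Uy; rewrite (PhiE (hw Uy)).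
exact: (smooth_expq oU dx_ sE (smooth_expq oU io_ sL sf)).
Qed.

Lemma smooth_PhiV f : smooth_ext U f -> smooth_ext U (fun y => PhiV (w y) (f y)).
Proof.
move=> sf; apply: (smooth_expq oU io_ (A := fun y => - (inv_2i *: P y))).
  apply: (eq_smooth_mx oU (A := fun y => (-1) *: (inv_2i *: P y))).
    by move=> y _; rewrite scaleN1r.
  exact: smooth_mxZ.
apply: (smooth_expq oU dx_ (A := fun y => - ('i%C *: form_mx (w y)))); last exact: sf.
apply: (eq_smooth_mx oU (A := fun y => (-1) *: ('i%C *: form_mx (w y)))).
  by move=> y _; rewrite scaleN1r.
exact: smooth_mxZ.
Qed.

Lemma smooth_Lambda f : smooth_ext U f -> smooth_ext U (fun y => Lambda (w y) (f y)).
Proof.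
move=> sf; apply: (eq_smooth_ext oU (f := fun y => quad io_ (P y) (f y))).
  by move=> y _; rewrite LambdaE.
exact: (smooth_quad oU io_ (smooth_Poisson oU sw uw) sf).
Qed.

Lemma dpart_Lambda k f x : smooth_ext U f -> U x ->
  dpart k (fun y => Lambda (w y) (f y)) x =
  Lambda (w x) (dpart k f x) + quad io_ (dmx k P x) (f x).
Proof.
move=> sf Ux; rewrite (eq_dpart oU _ (g := fun y => quad io_ (P y) (f y))) //.
  by rewrite (dpart_quad oU io_ k (smooth_Poisson oU sw uw) sf Ux) LambdaE.
by move=> y _; rewrite LambdaE.
Qed.

Lemma dpart_Phi k f x : smooth_ext U f -> U x ->
  dpart k (fun y => Phi (w y) (f y)) x =
  Phi (w x) (dpart k f x + inv_2i *: quad io_ (dmx k P x) (f x)) +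
  'i%C *: Eq x (ext_wedge (dpart k w x) (Lq x (f x))).
Proof.
move=> sf Ux; rewrite (eq_dpart oU _ (g := fun y => Eq y (Lq y (f y)))) //; last first.
  by move=> y Uy; rewrite (PhiE (hw Uy)).
rewrite (dpart_expq oU dxA k sE (smooth_expq oU io_ sL sf) Ux).
rewrite (dpart_expq oU ioA k sL sf Ux) expqD.
have hk := homogeneous_dpart (k := k) oU hw Ux.
rewrite (dmxZ oU k _ (smooth_Poisson oU sw uw) Ux) quadZ.
rewrite (dmxZ oU k _ (smooth_form_mx oU sw) Ux) quadZ expqZ.
by rewrite (dmx_form_mx oU k sw Ux) -(ext_wedge_hom2 hk) (PhiE (hw Ux)).
Qed.

(** The commutator of Lambda with dx_k contracts the partial derivative of f, and
    differentiating Lambda f along a coordinate also differentiates the bivector. *)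
Lemma commutator_Lambda_d f x : smooth_ext U f -> U x ->
  Lambda (w x) (ext_d f x) - ext_d (fun y => Lambda (w y) (f y)) x =
  - \sum_k (dxw k (quad io_ (dmx k P x) (f x)) + eta (w x) k (dpart k f x)).
Proof.
move=> sf Ux; have hx := hw Ux; have ux := uw Ux.
rewrite !ext_dE LambdaE (linear_sum (quad io_ (P x))) -sumrB -sumrN.
apply: eq_bigr => k _.
rewrite dpart_Lambda // (linearD (dx_ k)) /= LambdaE.
rewrite (quad_comm (X := dx_ k) (t := io_) (s := fun i => (k == i)%:R)) ?Poisson_antisym //.
  have := sum_delta1 (Poisson (w x)) (fun j => io_ j (dpart k f x)) k 1.
  rewrite !scale1r => ->; rewrite -lincombE -/(eta _ _ _).
  by rewrite -addrA opprD addrA subrr add0r [in RHS]addrC.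
by move=> i v; exact: dxw_iota.
Qed.

Hypothesis dw : forall y, U y -> ext_d w y = 0.

(** The terms with a derivative of e^(iw) add up to the wedge product with dw. The
    terms of second order in 1/2i vanish by [sum_eta_quad_dPoisson], and those of
    first order are given by [commutator_Lambda_d]. *)
Lemma ext_d_Phi f x : smooth_ext U f -> U x ->
  ext_d (fun y => Phi (w y) (f y)) x =
  Phi (w x) (ext_d f x - inv_2i *: (Lambda (w x) (ext_d f x) -
                                 ext_d (fun y => Lambda (w y) (f y)) x)).
Proof.
move=> sf Ux; have hx := hw Ux; have ux := uw Ux.
rewrite [LHS]ext_dE; pose Q k := quad io_ (dmx k P x) (f x).
transitivity (\sum_k dxw k (Phi (w x) (dpart k f x + inv_2i *: Q k)) +
    'i%C *: Eq x (ext_wedge (ext_d w x) (Lq x (f x)))).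
  rewrite ext_dE ext_wedge_suml (linear_sum (Eq x)) scaler_sumr -big_split.
  apply: eq_bigr => k _; rewrite dpart_Phi // (linearD (dx_ k)) /=; congr (_ + _).
  rewrite (linearZ_LR (dx_ k)) /=; apply: (congr1 (fun v => 'i%C *: v)).
  by rewrite ext_wedge_dxw -(expq_comm0 _ _ (dxA k)).
rewrite dw // ext_wedge0l (linear0 (Eq x)) scaler0 addr0.
transitivity (\sum_k Phi (w x)
   (dxw k (dpart k f x) + inv_2i *: (dxw k (Q k) + eta (w x) k (dpart k f x)) +
    (inv_2i * inv_2i) *: eta (w x) k (Q k))).
  apply: eq_bigr => k _.
  rewrite (dxw_Phi hx ux).
  apply: (congr1 (Phi (w x))).
  rewrite (linearD (dx_ k)) (linearZ_LR (dx_ k)) /=.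
  rewrite /eta (linearD (lincomb io_ (P x) k)).
  rewrite (linearZ_LR (lincomb io_ (P x) k)) /= !scalerDr scalerA.
  by rewrite -!addrA; congr (_ + _); rewrite addrCA addrA addrA [X in X + _]addrC -addrA.
rewrite -Phi_sum //; apply: (congr1 (Phi (w x))).
rewrite big_split /= -scaler_sumr (sum_eta_quad_dPoisson oU sw hw uw dw) // scaler0 addr0.
rewrite -[X in _ - _ *: X]/(_ - _) commutator_Lambda_d // scalerN opprK.
by rewrite big_split /= -scaler_sumr ext_dE.
Qed.

End DPhi.

(** * Naturality under pullback *)

Section Naturality.
Variables (R : realType) (m : nat).
Local Notation C := R[i].
Local Notation ext := (ext R m).
Local Notation io_ := (@io_ R m).
Implicit Types (w a b : ext) (i j k : 'I_m) (B : 'M[C]_m).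

Lemma pullbackE (A : 'M[R]_m) a :
  pullback A a = ext_hom (map_mx (real_complex R) A)^T a.
Proof.
rewrite ext_homE; apply: eq_bigr => J _; congr (_ *: _).
elim: (enum J) => //= j s ->; rewrite lincombE; apply: eq_bigr => i _.
by rewrite !mxE.
Qed.

Lemma hom_exp_op B (T T' : ext -> ext) a :
  (forall b, ext_hom B (T b) = T' (ext_hom B b)) ->
  ext_hom B (exp_op T a) = exp_op T' (ext_hom B a).
Proof.
move=> TT; rewrite /exp_op (linear_sum (ext_hom B)); apply: eq_bigr => n _.
rewrite (linearZ_LR (ext_hom B)); congr (_ *: _).
by elim: (n : nat) => //= p <-.
Qed.

Lemma hom_exp_iw B w : ext_hom B (exp_iw w) = exp_iw (ext_hom B w).
Proof.
rewrite /exp_iw (hom_exp_op (T' := ext_wedge ('i%C *: ext_hom B w))) ?hom1 // => b.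
by rewrite hom_wedge (linearZ_LR (ext_hom B)).
Qed.

Lemma hom_set0 B a : ext_hom B a finset.set0 = a finset.set0.
Proof.
elim/ext_ind: a => [z a b Ha Hb||i a _].
- by rewrite (linearP (ext_hom B)) /= !ffunE Ha Hb.
- by rewrite hom1.
- rewrite hom_dxw lincombE ext_sumE ffunE inE big1 // => j _.
  by rewrite extZE /= ffunE inE mulr0.
Qed.

Lemma iota_iota_hom B i j a : iota_ j (iota_ i (ext_hom B a)) =
  \sum_p \sum_q (B p i * B q j) *: ext_hom B (iota_ q (iota_ p a)).
Proof.
rewrite hom_iota (linear_sum (io_ j)); apply: eq_bigr => p _.
rewrite (linearZ_LR (io_ j)) /io_ /= hom_iota scaler_sumr; apply: eq_bigr => q _.
by rewrite scalerA.
Qed.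

Lemma form_mx_hom B w : form_mx (ext_hom B w) = B^T *m form_mx w *m B.
Proof.
apply/matrixP => i j.
transitivity (\sum_p \sum_q B p i * B q j * form_mx w p q).
  rewrite mxE iota_iota_hom ext_sumE; apply: eq_bigr => p _.
  rewrite ext_sumE; apply: eq_bigr => q _.
  by rewrite extZE hom_set0 [form_mx w p q]mxE.
rewrite exchange_big mxE; apply: eq_bigr => q _; rewrite mxE mulr_suml.
by apply: eq_bigr => p _; rewrite [B^T i p]mxE mulrAC.
Qed.

Section HomSymplectic.
Variables (B : 'M[C]_m) (w : ext).
Hypothesis uw : form_mx w \in unitmx.
Hypothesis uh : form_mx (ext_hom B w) \in unitmx.

(** The substitution relates two nondegenerate forms. *)
Lemma hom_unit : B \in unitmx.
Proof. by move: uh; rewrite form_mx_hom !unitmx_mul => /andP[]. Qed.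

(** Multiply (B^T W B)^-1 by B and B^T. *)
Lemma Poisson_hom : B *m Poisson (ext_hom B w) *m B^T = Poisson w.
Proof.
set X := _ *m B^T.
have XW : X *m form_mx w = - 1%:M.
  have : X *m form_mx w *m B = - B.
    have := Poisson_mul uh; rewrite form_mx_hom => /(congr1 (mulmx B)).
    by rewrite mulmxN mulmx1 /X !mulmxA.
  by move/(congr1 (fun A => A *m invmx B)); rewrite mulmxK ?hom_unit // mulNmx mulmxV ?hom_unit.
rewrite (Poisson_inv uw) -[LHS]mulmx1 -(mulmxV uw) mulmxA XW.
by rewrite mulNmx mul1mx.
Qed.

Lemma hom_Lambda a : ext_hom B (Lambda w a) = Lambda (ext_hom B w) (ext_hom B a).
Proof.
have hi j b : io_ j (ext_hom B b) = ext_hom B (lincomb io_ B^T j b).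
  rewrite /io_ /= hom_iota lincombE (linear_sum (ext_hom B)); apply: eq_bigr => k _.
  by rewrite (linearZ_LR (ext_hom B)) mxE.
rewrite !LambdaE -Poisson_hom.
have := quad_lincomb io_ (Poisson (ext_hom B w)) B^T a; rewrite trmxK => <-.
rewrite !quadE.
rewrite (linearZ_LR (ext_hom B)) (linear_sum (ext_hom B)); congr (_ *: _).
apply: eq_bigr => i _; rewrite (linear_sum (ext_hom B)); apply: eq_bigr => j _.
by rewrite (linearZ_LR (ext_hom B)) /= !hi.
Qed.

Lemma hom_Phi a : ext_hom B (Phi w a) = Phi (ext_hom B w) (ext_hom B a).
Proof.
rewrite Phi.unlock hom_wedge hom_exp_iw; apply: (congr1 (ext_wedge _)).
by apply: hom_exp_op => b; rewrite (linearZ_LR (ext_hom B)) /= hom_Lambda.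
Qed.

End HomSymplectic.

(** Nondegeneracy is a condition on real vectors; as [w] is real, the kernel of its
    complex matrix is spanned by real vectors. *)
Lemma form_mx_unit w : homogeneous 2 w -> (forall I, complex.Im (w I) = 0) ->
    (forall X : 'rV[R]_m, contr (map_mx (real_complex R) X) w = 0 -> X = 0) ->
  form_mx w \in unitmx.
Proof.
move=> hw rw nd.
have riota i a : (forall I, complex.Im (a I) = 0) ->
    forall I, complex.Im (iota_ i a I) = 0.
  move=> ra I; rewrite ffunE; case: ifP => // _.
  rewrite /koszul_sign -signr_odd; case: (odd _); rewrite ?expr1 ?mulN1r ?mul1r //.
  by move: (ra (i |: I)%SET); case: (a _) => x y /= ->; rewrite oppr0.
pose W := map_mx (@complex.Re R) (form_mx w).
have WE : form_mx w = map_mx (real_complex R) W.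
  apply/matrixP => i j; rewrite /W; move: (riota j _ (riota i _ rw) finset.set0).
  by rewrite !mxE; case: (_ finset.set0) => x y /= ->.
rewrite WE map_unitmx -row_free_unit -kermx_eq0; apply/eqP/row_matrixP => i.
rewrite row0; apply: nd.
transitivity (\sum_j (map_mx (real_complex R) (row i (kermx W)) *m form_mx w) 0 j
  *: dxw j (ext1 R m)).
  rewrite /contr; under eq_bigr do rewrite (iota_hom2 _ hw) scaler_sumr.
  rewrite exchange_big; apply: eq_bigr => j _; rewrite mxE scaler_suml.
  by apply: eq_bigr => k _; rewrite scalerA.
rewrite WE -map_mxM -row_mul mulmx_ker row0 map_mx0 big1 // => j _.
by rewrite mxE scale0r.
Qed.

End Naturality.

(** * Degree shifts *)

Section Grading.
Local Open Scope classical_set_scope.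
Variables (R : realType) (n : nat) (U : set 'rV[R]_(2 * n)).
Local Notation m := (2 * n)%N.
Hypothesis oU : open U.
Local Notation E := 'rV[R]_m.
Local Notation ext := (ext R m).
Local Notation dx_ := (@dx_ R m).
Local Notation io_ := (@io_ R m).
Local Notation inv_2i := (inv_2i R).
Implicit Types (f g : E -> ext) (x y : E) (i j : 'I_m) (k : int).

Lemma eq_ext_d f g x : (forall y, U y -> f y = g y) -> U x -> ext_d f x = ext_d g x.
Proof.
by move=> fg Ux; rewrite !ext_dE; apply: eq_bigr => k _; rewrite (eq_dpart oU k fg Ux).
Qed.

Lemma ext_d_homc k f x : smooth_ext U f -> U x ->
  ext_d (fun y => homc k (f y)) x = homc (k + 1) (ext_d f x).
Proof.
move=> sf Ux; rewrite !ext_dE (linear_sum (homc _)); apply: eq_bigr => i _.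
by rewrite /= homc_dxw addrK (dpart_linear oU (homc k) i sf Ux).
Qed.

Lemma Lambda_homc (w a : ext) k : Lambda w (homc k a) = homc (k - 2) (Lambda w a).
Proof. by rewrite !LambdaE homc_quad_io subrK. Qed.

Variable w : E -> ext.
Hypothesis sw : smooth_ext U w.
Hypothesis hw : forall y, U y -> homogeneous 2 (w y).
Hypothesis uw : forall y, U y -> form_mx (w y) \in unitmx.
Hypothesis rw : forall y, U y -> forall I, complex.Im (w y I) = 0.
Hypothesis dw : forall y, U y -> ext_d w y = 0.

(** The local expression of [deltaf]. *)
Definition delta_at f x : ext :=
  Lambda (w x) (ext_d f x) - ext_d (fun y => Lambda (w y) (f y)) x.

Lemma delta_at_homc k f x : smooth_ext U f -> U x ->
  delta_at (fun y => homc k (f y)) x = homc (k - 1) (delta_at f x).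
Proof.
move=> sf Ux; rewrite /delta_at (linearB (homc _)) /=.
apply: (congr2 (fun u v => u - v)).
  by rewrite (ext_d_homc k sf Ux) Lambda_homc -addrA.
apply: (etrans (eq_ext_d (fun y _ => Lambda_homc (w y) (f y) k) Ux)).
apply: (etrans (ext_d_homc (k - 2) (smooth_Lambda oU sw uw sf) Ux)).
by rewrite -addrA.
Qed.

(** In terms of degrees the two projections and phi disappear, by [Uproj_Phi] and
    [ext_d_Phi]: d has degree 1 and delta has degree -1, so at most one of the two
    terms survives for s = 1 or s = -1. *)
Lemma Uproj_d_Phi (j s : int) f x : smooth_ext U f -> U x ->
  Uproj (w x) (n%:Z - j + s)
    (ext_d (fun y => Uproj (w y) (n%:Z - j) (Phi (w y) (f y))) x) =
  Phi (w x) (homc (j - s) (homc (j + 1) (ext_d f x) - inv_2i *: homc (j - 1) (delta_at f x))).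
Proof.
move=> sf Ux; have sj := smooth_ext_linear oU (homc j) sf.
rewrite (@eq_ext_d _ (fun y => Phi (w y) (homc j (f y)))) //; last first.
  by move=> y Uy; rewrite (Uproj_Phi (hw Uy) (uw Uy) (rw Uy)) subKr.
rewrite (ext_d_Phi oU sw hw uw dw sj Ux) (Uproj_Phi (hw Ux) (uw Ux) (rw Ux)).
rewrite -/(delta_at (fun y => homc j (f y)) x).
rewrite (delta_at_homc j sf Ux) (ext_d_homc j sf Ux).
by rewrite opprD addrA subKr.
Qed.

Lemma sum_homc_d f x : \sum_(j < m.+1) homc (j%:Z + 1) (ext_d f x) = ext_d f x.
Proof.
rewrite ext_dE; under eq_bigr do rewrite (linear_sum (homc _)).
rewrite exchange_big; apply: eq_bigr => k _ /=.
under eq_bigr do rewrite homc_dxw addrK.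
by rewrite -(linear_sum (dx_ k)) sum_homc.
Qed.

Lemma sum_homc_delta f x : smooth_ext U f -> U x ->
  \sum_(j < m.+1) homc (j%:Z - 1) (delta_at f x) = delta_at f x.
Proof.
move=> sf Ux; rewrite /delta_at (commutator_Lambda_d oU sw hw uw sf Ux).
under eq_bigr do rewrite (linearN (homc _)) (linear_sum (homc _)) /=.
rewrite sumrN exchange_big; congr (- _); apply: eq_bigr => k _ /=.
under eq_bigr do rewrite (linearD (homc _)) /=.
rewrite big_split /=; congr (_ + _).
  under eq_bigr do rewrite homc_dxw homc_quad_io -!addrA addr0.
  by rewrite -(linear_sum (dx_ k)) -(linear_sum (quad io_ _)) sum_homc.
have eh (j : nat) v : homc (j%:Z - 1) (eta (w x) k v) = eta (w x) k (homc j%:Z v).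
  rewrite /eta !lincombE (linear_sum (homc _)); apply: eq_bigr => i _.
  by rewrite (linearZ_LR (homc _)) /= homc_iota subrK.
under eq_bigr do rewrite eh.
by rewrite -(linear_sum (lincomb io_ _ k)) sum_homc.
Qed.

Lemma d_lower_Phi f x : smooth_ext U f -> U x ->
  \sum_(j < m.+1) Uproj (w x) (n%:Z - j%:Z + -1)
     (ext_d (fun y => Uproj (w y) (n%:Z - j%:Z) (Phi (w y) (f y))) x) =
  Phi (w x) (ext_d f x).
Proof.
move=> sf Ux; rewrite -[in RHS]sum_homc_d (Phi_sum (hw Ux)).
apply: eq_bigr => j _; rewrite Uproj_d_Phi //; apply: (congr1 (Phi (w x))).
rewrite (linearB (homc _)) (linearZ_LR (homc _)) /= !homc_homc opprK eqxx.
by rewrite (inj_eq (addrI _)) scaler0 subr0.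
Qed.

Lemma d_raise_Phi f x : smooth_ext U f -> U x ->
  \sum_(j < m.+1) Uproj (w x) (n%:Z - j%:Z + 1)
     (ext_d (fun y => Uproj (w y) (n%:Z - j%:Z) (Phi (w y) (f y))) x) =
  - Phi (w x) (inv_2i *: delta_at f x).
Proof.
move=> sf Ux; rewrite -[in RHS](sum_homc_delta sf Ux) scaler_sumr (Phi_sum (hw Ux)) -sumrN.
apply: eq_bigr => j _; rewrite Uproj_d_Phi // -(PhiN (hw Ux)).
apply: (congr1 (Phi (w x))).
rewrite (linearB (homc _)) (linearZ_LR (homc _)) /= !homc_homc eqxx.
by rewrite (inj_eq (addrI _)) sub0r.
Qed.

End Grading.

(** * Forms on the manifold *)

Section Charts.
Local Open Scope classical_set_scope.
Variables (R : realType) (n : nat) (M : manifold R (2 * n)) (w : local_exprs M).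
Hypothesis hw : symplectic w.
Local Notation U c := (chart_img (chart_of c)).

Lemma open_chart_img (c : atlas M) : open (U c).
Proof. by case: M c => T A ch H1 H2 H3 H4 H5 c; have [] := H3 c. Qed.

Lemma phiE a c x : phi w a c x = Phi (w c x) (a c x).
Proof. by rewrite Phi.unlock. Qed.

Lemma overlap_img (c1 c2 : atlas M) x : overlap (chart_of c1) (chart_of c2) x ->
  U c1 x /\ U c2 (transition (chart_of c1) (chart_of c2) x).
Proof.
have chP (c : atlas M) : is_chart (chart_of c).
  by case: M c => T A ch H1 H2 H3 H4 H5 c; exact: H3.
move=> [p [p1 p2] <-]; split; first by exists p.
exists p => //; rewrite /transition.
by have [_ _ -> //] := chP c1.
Qed.

Lemma symplectic_smooth c : smooth_ext (U c) (w c).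
Proof. by have [[sw _] _ _ _] := hw; exact: sw. Qed.

Lemma symplectic_hom2 c x : U c x -> homogeneous 2 (w c x).
Proof. by have [_ h _ _] := hw; move=> /h []. Qed.

Lemma symplectic_real c x : U c x -> forall I, complex.Im (w c x I) = 0.
Proof. by have [_ h _ _] := hw; move=> /h []. Qed.

Lemma symplectic_closed c x : U c x -> ext_d (w c) x = 0.
Proof. by have [_ _ h _] := hw; exact: h. Qed.

Lemma symplectic_unit c x : U c x -> form_mx (w c x) \in unitmx.
Proof.
have [_ _ _ h] := hw; move=> Ux; apply: form_mx_unit (h c x Ux).
  exact: symplectic_hom2.
exact: symplectic_real.
Qed.

Lemma phi_form a : is_form a -> is_form (phi w a).
Proof.
move=> [sa pa]; split=> [c|c1 c2 x ox F].
  have := smooth_Phi (open_chart_img (c := c)) (symplectic_smooth c)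
    (@symplectic_hom2 c) (@symplectic_unit c) (sa c).
  by apply: (eq_smooth_ext (open_chart_img (c := c))) => y _; rewrite phiE.
have [_ pw] := let: And4 h _ _ _ := hw in h.
have [x1 x2] := overlap_img ox.
have eqw := pw c1 c2 x ox; have eqa := pa c1 c2 x ox.
rewrite /= in eqw eqa; rewrite !phiE eqa.
have := symplectic_unit x1; rewrite eqw !pullbackE => uh.
by rewrite hom_Phi // symplectic_unit.
Qed.

Definition phi_inv (b : local_exprs M) : local_exprs M :=
  fun c x => PhiV (w c x) (b c x).

(** As phi is natural and invertible at every point, so is its inverse. *)
Lemma phi_inv_form b : is_form b -> is_form (phi_inv b).
Proof.
move=> [sb pb]; split=> [c|c1 c2 x ox F].
  exact: (smooth_PhiV (open_chart_img (c := c)) (symplectic_smooth c) (@symplectic_unit c) (sb c)).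
have [_ pw] := let: And4 h _ _ _ := hw in h.
have [x1 x2] := overlap_img ox.
have eqw := pw c1 c2 x ox; have eqb := pb c1 c2 x ox.
rewrite /= in eqw eqb; rewrite /phi_inv eqb.
have := symplectic_unit x1; have := symplectic_hom2 x1; rewrite eqw !pullbackE => h1 uh.
rewrite -[in LHS](PhiVK (symplectic_hom2 x2) (b c2 _)) hom_Phi ?symplectic_unit //.
by rewrite PhiK.
Qed.

Lemma phi_linear_iso : linear_iso (phi w).
Proof.
split.
- exact: phi_form.
- move=> z a b _ _ c x /symplectic_hom2 hx.
  by rewrite /form_add /form_scale !phiE PhiD // PhiZ.
- move=> a b _ _ ab c x Ux; have hx := symplectic_hom2 Ux.
  by rewrite -(PhiK hx (a c x)) -(PhiK hx (b c x)) -!phiE ab.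
- move=> b fb; exists (phi_inv b); first exact: phi_inv_form.
  by move=> c x Ux; rewrite phiE PhiVK //; exact: symplectic_hom2.
Qed.

End Charts.

Theorem theorem5p2 (R : realType) (n : nat) (M : manifold R (2 * n))
    (w : local_exprs M) (hw : symplectic w) :
  linear_iso (phi w) /\
  forall a : local_exprs M, is_form a ->
    [/\ eqform (dform (phi w a))
               (phi w (form_add (dform a) (form_scale (- (2 * 'i%C)^-1) (deltaf w a)))),
        eqform (delbar w (phi w a)) (phi w (dform a)),
        eqform (del w (phi w a))
               (form_scale (-1) (phi w (form_scale (2 * 'i%C)^-1 (deltaf w a)))),
        eqform (phi w (dform a)) (delbar w (phi w a)) &
        eqform (phi w (deltaf w a)) (form_scale (- (2 * 'i%C)) (del w (phi w a)))].
Proof.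
split=> [|a [sa _]]; first exact: phi_linear_iso.
have ophi c : phi w a c = (fun y => Phi (w c y) (a c y)).
  by apply/funext => y; rewrite phiE.
have deltaE c x : deltaf w a c x = delta_at (w c) (a c) x.
  by rewrite /deltaf /form_add /form_scale scaleN1r.
have dbarE : eqform (delbar w (phi w a)) (phi w (dform a)).
  move=> c x Ux; rewrite phiE /dform.
  rewrite -(d_lower_Phi (open_chart_img (c := c)) (symplectic_smooth hw c)
    (symplectic_hom2 hw (c := c)) (symplectic_unit hw (c := c))
    (symplectic_real hw (c := c)) (symplectic_closed hw (c := c)) (sa c) Ux).
  by rewrite /delbar /d_shift /Uprojf /dform ophi.
have delE : eqform (del w (phi w a))
    (form_scale (-1) (phi w (form_scale (2 * 'i%C)^-1 (deltaf w a)))).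
  move=> c x Ux; rewrite /form_scale phiE deltaE scaleN1r.
  rewrite -(d_raise_Phi (open_chart_img (c := c)) (symplectic_smooth hw c)
    (symplectic_hom2 hw (c := c)) (symplectic_unit hw (c := c))
    (symplectic_real hw (c := c)) (symplectic_closed hw (c := c)) (sa c) Ux).
  by rewrite /del /d_shift /Uprojf /dform ophi.
split; [|exact: dbarE|exact: delE|by move=> c x Ux; rewrite dbarE|].
- move=> c x Ux; rewrite phiE /dform ophi.
  rewrite (ext_d_Phi (open_chart_img (c := c)) (symplectic_smooth hw c)
    (symplectic_hom2 hw (c := c)) (symplectic_unit hw (c := c))
    (symplectic_closed hw (c := c)) (sa c) Ux).
  by rewrite /form_add /form_scale deltaE scaleNr.
- move=> c x Ux; have hx := symplectic_hom2 hw Ux.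
  rewrite {1}/form_scale delE // /form_scale !phiE PhiZ // !scalerA.
  rewrite mulrN1 opprK mulfV ?scale1r // mulf_neq0 ?pnatr_eq0 //.
  exact: imaginary_neq0.
Qed.
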